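(* Let $(t_N)_{N\in\mathbb{N}}$ be a sequence of real numbers with $t_N\to\infty$ as $N\to\infty$, and let $\beta>0$. Consider the random variables $$W_N \;:=\; \frac{e^{\frac{N}{2}(\log 2-\beta^2)}}{t_N}\,\log\left(\frac{Z_N(\beta)}{\mathbb{E} Z_N(\beta)}\right).$$ (i) Let $\beta<\sqrt{\log 2/2}$. Then $W_N$ satisfies the large deviation principle, in the following sense. If $t_N=o(\sqrt{N})$, then $(W_N)_N$ satisfies the LDP on $\mathbb{R}$ with speed $t_N^2$ and good rate function $I(x)=\frac{x^2}{2}$. Otherwise, if $\liminf_{N\to\infty}\frac{t_N}{\sqrt{N}}>0$, then for any speed $\gamma_N=o(N)$ (with $\gamma_N\to\infty$), $(W_N)_N$ satisfies the LDP on $\mathbb{R}$ with speed $\gamma_N$ and good rate function $$I(x)=\begin{cases}0 & \text{if } x=0,\\ \infty & \text{if } x\neq 0.\end{cases}$$ (ii) Let $\beta=\sqrt{\log 2/2}$. Then, for any scaling $t_N=o(\sqrt{\log N})$, $(W_N)_N$ satisfies the LDP on $\mathbb{R}$ with speed $t_N^2$ and good rate function $I(x)=x^2$.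
   Context: Random energy model: for $N\in\mathbb{N}$ let $\mathcal{S}_N=\{-1,+1\}^N$. Let $(\Omega,\mathcal{F},P)$ be a probability space carrying a triangular array $(X_\sigma:\sigma\in\mathcal{S}_N,\ N\in\mathbb{N})$ of independent $\mathcal{N}(0,1)$-distributed random variables; $\mathbb{E}$ denotes expectation with respect to $P$. For inverse temperature $\beta>0$ the partition function is $$Z_N(\beta)=\sum_{\sigma\in\mathcal{S}_N}e^{\beta\sqrt{N}X_\sigma}$$ (also written $Z_{\beta,N}$). Large deviation principle: let $\gamma_N\to\infty$ be a sequence of real numbers and $I:\mathbb{R}\to[0,\infty]$ a lower semicontinuous function. A sequence of real random variables $(W_N)_{N\in\mathbb{N}}$ satisfies the large deviation principle (LDP) with speed $\gamma_N$ and rate function $I$ if for every Borel set $A\subseteq\mathbb{R}$, with interior $A^\circ$ and closure $\overline{A}$, $$-\inf_{x\in A^\circ}I(x)\le\liminf_{N\to\infty}\frac{1}{\gamma_N}\log P(W_N\in A)\le\limsup_{N\to\infty}\frac{1}{\gamma_N}\log P(W_N\in A)\le-\inf_{x\in\overline{A}}I(x).$$ The rate function is good if its level sets $\{x:I(x)\le c\}$ are compact for all $c\in\mathbb{R}$. Conventions: $\log 0=-\infty$, $\inf\emptyset=\infty$. *)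

(* Defs.v *)
From HB Require Import structures.
From mathcomp Require Export all_boot all_order all_algebra finmap.
From mathcomp Require Export all_classical all_reals all_analysis measurable_realfun.

Set Implicit Arguments.
Unset Strict Implicit.
Unset Printing Implicit Defensive.

Export Order.TTheory GRing.Theory Num.Theory.
Export numFieldNormedType.Exports.

Local Open Scope classical_set_scope.
Local Open Scope ring_scope.

Section probability_notions.
Context {d : measure_display} {T : measurableType d} {R : realType}.
Variable P : probability T R.

Definition mutually_independent (I : choiceType) (X : I -> {RV P >-> R}) :=
  forall (J : {fset I}) (A : I -> set R), (forall i, measurable (A i)) ->
    P (\bigcap_(i in [set` J]) (X i @^-1` A i)) =
    (\prod_(i <- J) P (X i @^-1` A i))%E.

Definition standard_gaussian (X : {RV P >-> R}) :=
  forall A : set R, measurable A -> distribution P X A = normal_prob 0 1 A.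

(* [lne 0 = -oo] and [ereal_inf set0 = +oo]. *)
Definition ldp (W : nat -> {RV P >-> R}) (gamma : nat -> R) (I : R -> \bar R) :=
  [/\ gamma @ \oo --> +oo,
      (forall x, 0 <= I x)%E,
      lower_semicontinuous I &
      forall A : set R, measurable A ->
        let rate N := ((gamma N)^-1%:E * lne (P (W N @^-1` A)))%E in
        [/\ (- ereal_inf (I @` A°) <= limn_einf rate)%E,
            (limn_einf rate <= limn_esup rate)%E &
            (limn_esup rate <= - ereal_inf (I @` closure A))%E]].

End probability_notions.

Definition good_rate_function {R : realType} (I : R -> \bar R) :=
  forall c : R, compact [set x | (I x <= c%:E)%E].

(* The configuration space {-1,+1}^N, with [true] standing for +1 and [false]
   for -1. *)
Notation spins N := {ffun 'I_N -> bool}.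

Section random_energy_model.
Context {d : measure_display} {T : measurableType d} {R : realType}.
Variable P : probability T R.
Variable X : forall N, spins N -> {RV P >-> R}.

(* Independence is joint over all the entries of the triangular array, across
   the different values of N as well. *)
Definition rem_disorder :=
  (forall N (s : spins N), standard_gaussian (X s)) /\
  mutually_independent (fun i : {N : nat & spins N} => X (tagged i)).

Definition partition_fun (beta : R) (N : nat) : T -> R :=
  fun w => \sum_(s : spins N) expR (beta * Num.sqrt N%:R * X s w).

(* Under [rem_disorder], 'E_P[partition_fun beta N] is finite and positive. *)
Definition scaled_log_partition (t : nat -> R) (beta : R) (N : nat) : T -> R :=
  fun w => expR (N%:R / 2 * (ln 2 - beta ^+ 2)) / t N *
    ln (partition_fun beta N w / fine 'E_P[partition_fun beta N]).

Lemma measurable_partition_fun beta N :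
  measurable_fun [set: T] (partition_fun beta N).
Proof.
apply: measurable_sum => s.
by apply: measurableT_comp => //; exact: measurable_funM.
Qed.

Lemma measurable_scaled_log_partition t beta N :
  measurable_fun [set: T] (scaled_log_partition t beta N).
Proof.
apply: measurable_funM => //; apply: measurableT_comp => //.
by apply: measurable_funM => //; exact: measurable_partition_fun.
Qed.

HB.instance Definition _ t beta N := isMeasurableFun.Build _ _ _ _
  (scaled_log_partition t beta N) (measurable_scaled_log_partition t beta N).

End random_energy_model.

(* Main.v *)
(* Write Z_N / E Z_N = 1 + Y_N / a_N with a_N = exp (N (ln 2 - beta^2) / 2), so
   that Y_N is a sum of 2^N i.i.d. centred terms of total variance tending to 1,
   and W_N is Y_N / t_N up to the negligible curvature of the logarithm.
   Replace Y_N by its truncation to the configurations with X_s <= L_N: the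
   union bound makes the error superexponentially small at speed t_N^2, every
   remaining summand is small compared with 1 / t_N, and a second-order
   expansion of the exponential gives
     t_N^-2 ln E exp (lambda t_N Y_N) -> lambda^2 v / 2.
   The Gaussian tilts of mean beta sqrt N and 2 beta sqrt N express the truncated
   mean and variance through normal tails at L_N.  For beta < sqrt (ln 2 / 2),
   L_N = l sqrt N keeps the whole variance, v = 1.  At beta = sqrt (ln 2 / 2) the
   second moment is carried by X_s close to 2 beta sqrt N, which is also the order
   of the maximum of the X_s, and the truncation keeps only one half of it,
   v = 1/2.  The case liminf t_N / sqrt N > 0 follows by comparing W_N with its
   version at scale sqrt gamma_N. *)
Require Import Defs.
From mathcomp Require Import ring lra.

Local Open Scope classical_set_scope.
Local Open Scope ring_scope.

(** * Calculus and extended real limits *)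

Section calculus.
Context {R : realType}.
Implicit Types u v w x : R.

(* The auxiliary function is [(1 + v + v^2/2) e^{-v}], of derivative
   [- v^2/2 e^{-v}]. *)
Lemma expR_taylor2 v : `|v| <= 1 ->
  `|expR v - (1 + v + v ^+ 2 / 2)| <= 8 * `|v| ^+ 3.
Proof.
move=> v1.
have e1 : expR 1 <= 4 :> R.
  have h : 2^-1 <= expR (- 2^-1) :> R.
    by apply: le_trans (expR_ge1Dx _); lra.
  have -> : 1 = 2^-1 + 2^-1 :> R by lra.
  rewrite expRD -[X in expR X](opprK 2^-1) expRN.
  have h2 : (expR (- 2^-1 : R))^-1 <= 2.
    by rewrite -[leRHS]invrK lef_pV2// posrE ?expR_gt0.
  have h0 : 0 <= (expR (- 2^-1 : R))^-1 by rewrite invr_ge0 expR_ge0.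
  by nra.
have ub x : `|x| <= 1 -> expR x <= 4.
  by move=> x1; apply: le_trans e1; rewrite ler_expR; move: x1; rewrite ler_norml => /andP[].
pose g x : R := (1 + x + x ^+ 2 / 2) * expR (- x).
pose dg x : R := - (x ^+ 2 / 2) * expR (- x).
have gd x : is_derive x 1 g (dg x).
  apply: is_derive_eq.
  rewrite !scaler0 ?scaler1 /dg /GRing.scale/=.
  by field.
have cg a b : {within `[a, b], continuous g}.
  apply/continuous_subspaceT => r.
  by apply/differentiable_continuous/derivable1_diffP; case: (gd r).
have key : exists2 c, `|c| <= `|v| & `|g v - 1| = `|dg c| * `|v|.
  have g0 : g 0 = 1 by rewrite /g oppr0 expR0; lra.
  have [v0|/ltW v0] := leP 0 v.
    have [c cv gv] := MVT_segment v0 (fun x _ => gd x) (cg _ _).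
    exists c; last by rewrite -g0 gv subr0 normrM.
    by move: cv; rewrite in_itv/= => /andP[c0 cv]; rewrite !ger0_norm.
  have [c cv gv] := MVT_segment v0 (fun x _ => gd x) (cg _ _).
  exists c.
    by move: cv; rewrite in_itv/= => /andP[c0 cv]; rewrite !ler0_norm// lerN2.
  by rewrite distrC -g0 gv sub0r normrM normrN.
have [c cv gv] := key.
have -> : expR v - (1 + v + v ^+ 2 / 2) = (1 - g v) * expR v.
  by rewrite mulrBl mul1r /g -[_ * expR v]mulrA -expRD addNr expR0 mulr1.
rewrite normrM distrC gv (ger0_norm (expR_ge0 _)) /dg.
rewrite normrM normrN (ger0_norm (expR_ge0 _)).
rewrite [X in X * _ * _ * _]ger0_norm; last by rewrite divr_ge0// sqr_ge0.
have h1 : expR (- c) <= 4 by apply: ub; rewrite normrN (le_trans cv).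
have h2 := ub _ v1.
have h3 : c ^+ 2 <= `|v| ^+ 2.
  by rewrite -(real_normK (num_real c)) lerXn2r// nnegrE.
rewrite (_ : 8 * _ = (`|v| ^+ 2 / 2 * 4) * `|v| * 4); last by rewrite exprS; field.
have c20 : 0 <= c ^+ 2 / 2 by rewrite divr_ge0// sqr_ge0.
have e0 := expR_ge0 (- c).
apply: ler_pM (expR_ge0 _) _ h2; first exact: mulr_ge0 (mulr_ge0 c20 e0) _.
by rewrite ler_wpM2r// ler_pM// ler_wpM2r// invr_ge0.
Qed.

Lemma expR_subsqr_le1D w : - 2^-1 <= w -> expR (w - 2 * w ^+ 2) <= 1 + w.
Proof.
move=> w2; have h : 1 + - (w - 2 * w ^+ 2) <= expR (- (w - 2 * w ^+ 2)) by exact: expR_ge1Dx.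
have p : 0 < 1 + - (w - 2 * w ^+ 2) by nra.
rewrite -[X in expR X]opprK expRN; apply: (@le_trans _ _ (1 + - (w - 2 * w ^+ 2))^-1).
  by rewrite lef_pV2// posrE (lt_le_trans p).
rewrite -[_^-1]mul1r ler_pdivrMr//.
have -> : (1 + w) * (1 + - (w - 2 * w ^+ 2)) = 1 + w ^+ 2 * (1 + 2 * w) by ring.
by rewrite lerDl mulr_ge0 ?sqr_ge0//; lra.
Qed.

Lemma ln1D_ge u : - 2^-1 <= u -> u - 2 * u ^+ 2 <= ln (1 + u).
Proof.
move=> u2; rewrite -ler_expR lnK; first exact: expR_subsqr_le1D.
by rewrite posrE; lra.
Qed.

End calculus.

Section limits.
Context {R : realType}.
Local Open Scope ereal_scope.

Lemma lte_between_real (x y : \bar R) : x < y -> exists r, x < r%:E < y.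
Proof.
case: x y => [x| |] [y| |]//=; rewrite ?lte_fin => xy.
- by exists ((x + y) / 2)%R; rewrite !lte_fin midf_lt//= midf_lt.
- by exists (x + 1)%R; rewrite lte_fin ltrDl ltr01 ltry.
- by exists (y - 1)%R; rewrite ltNyr lte_fin gtrBl ltr01.
- by exists 0%R; rewrite ltNyr ltry.
Qed.

Lemma limn_esup_le_near (u : (\bar R)^nat) (l : \bar R) :
  (\forall n \near \oo, u n <= l) -> limn_esup u <= l.
Proof.
move=> [m _ ul]; apply: ge_ereal_inf.
exists (ereal_sup (u @` [set k | (m <= k)%N])).
  by exists [set k | (m <= k)%N] => //; exists m.
by apply: ge_ereal_sup => _ [k /= mk <-]; exact: ul.
Qed.

Lemma limn_einf_ge_near (u : (\bar R)^nat) (l : \bar R) :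
  (\forall n \near \oo, l <= u n) -> l <= limn_einf u.
Proof.
move=> ul; rewrite /limn_einf leeNr; apply: limn_esup_le_near.
by near do rewrite leeN2.
Unshelve. all: by end_near. Qed.

Lemma lt_limn_einf_near (u : (\bar R)^nat) (l : \bar R) :
  l < limn_einf u -> \forall n \near \oo, l < u n.
Proof.
rewrite /limn_einf lteNr => /ereal_inf_lt[_ [A [m _ mA] <-]] Al.
exists m => // k /mA Ak.
rewrite -lteN2; apply: le_lt_trans Al.
by apply: ereal_sup_ubound; exists k.
Qed.

Lemma lne_ge (r : R) (p : \bar R) : (expR r)%:E <= p -> r%:E <= lne p.
Proof.
case: p => [p| |]//= h; last by rewrite leey.
move: h; rewrite lee_fin => rp; have p0 : (0 < p)%R by exact: lt_le_trans (expR_gt0 r) rp.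
by rewrite (lt_geF p0) lee_fin -ler_expR lnK.
Qed.

Lemma lne_le (r : R) (p : \bar R) : p <= (expR r)%:E -> lne p <= r%:E.
Proof.
case: p => [p|//|_]; last by rewrite leNye.
rewrite lee_fin => pr; have [p0|p0] := leP p 0%R.
  by rewrite le0_lneNy ?leNye.
by rewrite lne_EFin// lee_fin -ler_expR lnK.
Qed.

End limits.

Section norm_events.
Context {d : measure_display} {T : measurableType d} {R : realType}.
Variable f : T -> R.
Hypothesis mf : measurable_fun setT f.

Lemma measurable_le_norm (a : R) : measurable [set w | a <= `|f w|].
Proof.
rewrite (_ : [set w | _] = (fun w => `|f w|) @^-1` `[a, +oo[); last first.
  by apply/seteqP; split=> w /=; rewrite in_itv/= andbT.
rewrite -[X in measurable X]setTI.
have : measurable_fun setT (fun w => `|f w|) by exact: measurableT_comp.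
by apply.
Qed.

Lemma measurable_dist_lt (x e : R) : measurable [set w | `|f w - x| < e].
Proof.
rewrite (_ : [set w | _] = (fun w => `|f w - x|) @^-1` `]-oo, e[%classic); last first.
  by apply/seteqP; split=> w /=; rewrite in_itv.
rewrite -[X in measurable X]setTI.
have : measurable_fun setT (fun w => `|f w - x|).
  by apply: measurableT_comp => //; exact: measurable_funB.
by apply.
Qed.

Lemma measurable_le_scale (c a : R) : measurable [set w | a <= c * f w].
Proof.
rewrite (_ : [set w | _] = (fun w => c * f w) @^-1` `[a, +oo[); last first.
  by apply/seteqP; split=> w /=; rewrite in_itv/= andbT.
by rewrite -[X in measurable X]setTI; apply: measurable_funM.
Qed.

End norm_events.

Section large_deviations.
Context {d : measure_display} {T : measurableType d} {R : realType}.
Variable P : probability T R.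
Local Open Scope ereal_scope.

Lemma ldp_of_exp_bounds (W : nat -> {RV P >-> R}) (gamma : nat -> R)
    (I : R -> \bar R) :
  gamma @ \oo --> +oo%R -> (forall x, 0 <= I x) -> lower_semicontinuous I ->
  (forall (A : set R) (r s : R), measurable A -> (r < s)%R ->
    (forall x, closure A x -> s%:E <= I x) ->
    \forall N \near \oo, P (W N @^-1` A) <= (expR (- (gamma N * r)))%:E) ->
  (forall x delta r : R, (0 < delta)%R -> I x < r%:E ->
    \forall N \near \oo,
      (expR (- (gamma N * r)))%:E <= P (W N @^-1` ball x delta)) ->
  ldp W gamma I.
Proof.
move=> goo I0 lscI ub lb; split => // A mA rate.
have g0 : \forall N \near \oo, (0 < gamma N)%R.
  by have /cvgryPgt := goo; exact.
have rate_le A' r : (\forall N \near \oo, P (W N @^-1` A') <= (expR (- (gamma N * r)))%:E) ->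
    \forall N \near \oo, (gamma N)^-1%:E * lne (P (W N @^-1` A')) <= (- r)%:E.
  move=> Pr; near=> N.
  have gN : (0 < gamma N)%R by near: N.
  rewrite (_ : - r = (gamma N)^-1 * (- (gamma N * r)))%R; last first.
    by rewrite mulrN mulKf// gt_eqF.
  rewrite EFinM lee_pmul2l// ?lte_fin ?invr_gt0//; apply: lne_le.
  by near: N.
have rate_ge A' r : (\forall N \near \oo, (expR (- (gamma N * r)))%:E <= P (W N @^-1` A')) ->
    \forall N \near \oo, (- r)%:E <= (gamma N)^-1%:E * lne (P (W N @^-1` A')).
  move=> Pr; near=> N.
  have gN : (0 < gamma N)%R by near: N.
  rewrite (_ : - r = (gamma N)^-1 * (- (gamma N * r)))%R; last first.
    by rewrite mulrN mulKf// gt_eqF.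
  rewrite EFinM lee_pmul2l// ?lte_fin ?invr_gt0//; apply: lne_ge.
  by near: N.
split.
- rewrite leeNl; apply: le_ereal_inf_tmp => _ [x Ax <-].
  rewrite leeNl leNgt; apply/negP => /lte_between_real[r /andP[rl Ir]].
  have /nbhs_ballP[delta /= delta0 xA] : nbhs x A by exact: Ax.
  suff : r%:E <= limn_einf rate by rewrite leNgt rl.
  apply: limn_einf_ge_near.
  rewrite -(opprK r); apply: rate_ge.
  have Irx : I x < (- r)%:E by rewrite EFinN lteNr.
  have := lb _ _ _ delta0 Irx; apply: filterS => N /le_trans; apply.
  apply: le_measure; rewrite ?inE; last by apply: preimage_subset.
    by rewrite -[X in measurable X]setTI; apply: measurable_funP => //; exact: measurable_ball.
  by rewrite -[X in measurable X]setTI; exact: measurable_funP.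
- exact: limn_einf_sup.
- set J := ereal_inf _; rewrite leNgt; apply/negP => /lte_between_real[r /andP[Jr rl]].
  have [s /andP[Js sr]] := lte_between_real _ _ Jr.
  suff : limn_esup rate <= r%:E by rewrite leNgt rl.
  apply: limn_esup_le_near.
  rewrite -(opprK r); apply: rate_le; apply: (ub A _ (- s)%R) => //.
    by rewrite ltrN2 -lte_fin.
  move=> x clAx; rewrite EFinN leeNl; apply: le_trans (ltW Js); rewrite leeN2.
  by apply: ereal_inf_lbound; exists x.
Unshelve. all: by end_near. Qed.

End large_deviations.

(** * Exponential bounds from a quadratic limiting cumulant *)

Section gaussian_gartner_ellis.
Context {d : measure_display} {T : measurableType d} {R : realType}.
Variable P : probability T R.
Variables (G : nat -> T -> R) (gamma : nat -> R) (v : R).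
Hypothesis mG : forall N, measurable_fun setT (G N).
Hypothesis goo : gamma @ \oo --> +oo.
Hypothesis v0 : 0 < v.

Local Notation mgf N lambda := (\int[P]_w (expR (lambda * gamma N * G N w))%:E)%E.

Hypothesis mgf_bounds : forall lambda e : R, 0 < e -> \forall N \near \oo,
  ((expR (gamma N * (lambda ^+ 2 * v / 2 - e)))%:E <= mgf N lambda /\
   mgf N lambda <= (expR (gamma N * (lambda ^+ 2 * v / 2 + e)))%:E)%E.

Let mexp c N : measurable_fun setT (fun w => (expR (c * G N w))%:E).
Proof.
apply/measurable_EFinP; apply: measurableT_comp => //.
exact: measurable_funM.
Qed.

Lemma gartner_ellis_upper x r : r < x ^+ 2 / (2 * v) ->
  \forall N \near \oo,
    (P [set w | x ^+ 2 <= x * G N w]%R <= (expR (- (gamma N * r)))%:E)%E.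
Proof.
move=> rx; pose lambda := x / v; pose e := x ^+ 2 / (2 * v) - r.
have e0 : 0 < e by rewrite subr_gt0.
have g0 : \forall N \near \oo, 0 < gamma N by have /cvgryPgt := goo; exact.
near=> N.
have gN : 0 < gamma N by near: N.
set A := [set w | _].
have mA : measurable A by exact: measurable_le_scale.
have [_ up] : ((expR (gamma N * (lambda ^+ 2 * v / 2 - e)))%:E <= mgf N lambda /\
   mgf N lambda <= (expR (gamma N * (lambda ^+ 2 * v / 2 + e)))%:E)%E.
  by near: N; exact: mgf_bounds.
have cheb : ((expR (gamma N * (x ^+ 2 / v)))%:E * P A <= mgf N lambda)%E.
  rewrite -integral_cst// (le_trans (y := \int[P]_(w in A) (expR (lambda * gamma N * G N w))%:E)%E)//.
    apply: ge0_le_integral => //.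
    - by move=> w _; rewrite /= lee_fin expR_ge0.
    - by apply: measurable_funTS; exact: mexp.
    - move=> w; rewrite /A/= lee_fin ler_expR => Aw.
      rewrite (_ : lambda * gamma N * G N w = gamma N * (x * G N w / v)); last by rewrite /lambda; ring.
      by rewrite ler_pM2l// ler_pM2r// invr_gt0.
  by apply: ge0_subset_integral => //; exact: mexp.
have := le_trans cheb up.
rewrite -(@fineK _ (P A)) ?fin_num_measure// -EFinM !lee_fin mulrC -ler_pdivlMr ?expR_gt0//.
move=> /le_trans; apply; rewrite -expRN -expRD ler_expR.
rewrite /e /lambda le_eqVlt; apply/orP; left; apply/eqP; field.
exact: lt0r_neq0.
Unshelve. all: by end_near. Qed.

Let lower_pointwise N x delta eta : 0 < gamma N -> 0 < eta ->
  forall w, let lambda := x / v in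
  expR (lambda * gamma N * G N w) <=
  expR (gamma N * (lambda * x + `|lambda| * delta)) * \1_[set w | `|G N w - x| < delta] w +
  (expR (- (gamma N * eta * (x + delta))) * expR ((lambda + eta) * gamma N * G N w) +
   expR (gamma N * eta * (x - delta)) * expR ((lambda - eta) * gamma N * G N w)).
Proof.
move=> gN eta0 w /=; set lambda := x / v.
have [xB|xB] := boolP (`|G N w - x| < delta).
  rewrite indicE mem_set// mulr1; apply: ler_wpDr.
    by apply: addr_ge0; apply: mulr_ge0; rewrite expR_ge0.
  rewrite ler_expR -mulrA mulrCA ler_pM2l//.
  rewrite -lerBlDl -mulrBr (le_trans (ler_norm _))// normrM.
  by rewrite ler_wpM2l// ltW.
rewrite indicE memNset/= ?mulr0 ?add0r; last exact/negP.
move: xB; rewrite -leNgt ler_normr => /orP[xB|xB].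
  apply: ler_wpDr; first by rewrite mulr_ge0 ?expR_ge0.
  rewrite -expRD ler_expR.
  rewrite [leRHS](_ : _ = lambda * gamma N * G N w + gamma N * eta * (G N w - x - delta)); last by ring.
  by rewrite lerDl mulr_ge0 ?subr_ge0// mulr_ge0// ltW.
apply: ler_wpDl; first by rewrite mulr_ge0 ?expR_ge0.
rewrite -expRD ler_expR.
rewrite [leRHS](_ : _ = lambda * gamma N * G N w + gamma N * eta * (- (G N w - x) - delta)); last by ring.
by rewrite lerDl mulr_ge0 ?subr_ge0// mulr_ge0// ltW.
Qed.

Let lower_integrated N x delta eta : 0 < gamma N -> 0 < eta ->
  let lambda := x / v in
  (mgf N lambda <=
  (expR (gamma N * (lambda * x + `|lambda| * delta)))%:E * P [set w | `|G N w - x| < delta]%R +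
  ((expR (- (gamma N * eta * (x + delta))))%:E * mgf N (lambda + eta) +
   (expR (gamma N * eta * (x - delta)))%:E * mgf N (lambda - eta)))%E.
Proof.
move=> gN eta0 /=; set lambda := x / v; have mB := measurable_dist_lt (G N) (mG N) x delta.
have -> : P [set w | `|G N w - x| < delta] = (\int[P]_w (\1_[set w | `|G N w - x| < delta] w)%:E)%E.
  by rewrite integral_indic// setIT.
rewrite -ge0_integralZl//; last by apply/measurable_EFinP; exact: measurable_indic.
have e0 c k : (0 <= (expR (c * G N k))%:E)%E by rewrite lee_fin expR_ge0.
have mZ c b : measurable_fun setT (fun w => ((expR b)%:E * (expR (c * G N w))%:E)%E).
  by apply: emeasurable_funM => //; exact: mexp.
rewrite -!ge0_integralZl//; try exact: mexp; try by rewrite lee_fin expR_ge0.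
have mI : measurable_fun setT (fun w => ((expR (gamma N * (lambda * x + `|lambda| * delta)))%:E *
    (\1_[set w | `|G N w - x| < delta]%R w)%:E)%E).
  by apply: emeasurable_funM => //; apply/measurable_EFinP; exact: measurable_indic.
have mD c1 b1 c2 b2 : measurable_fun setT (fun w => ((expR b1)%:E * (expR (c1 * G N w))%:E +
    (expR b2)%:E * (expR (c2 * G N w))%:E)%E).
  by apply: emeasurable_funD; exact: mZ.
rewrite -ge0_integralD//.
rewrite -ge0_integralD//.
apply: ge0_le_integral => //.


- exact: emeasurable_funD.
- by move=> w _; rewrite -!EFinM -!EFinD lee_fin; exact: lower_pointwise.
- by move=> w _; rewrite adde_ge0// mule_ge0// lee_fin expR_ge0.
Qed.

(* No change of measure: for [lambda = x / v] the part of the exponential moment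
   carried by [|G - x| >= delta] is exponentially negligible, by the exponential
   Chebyshev inequality at the neighbouring parameters [lambda + eta] and
   [lambda - eta]. *)
Lemma gartner_ellis_lower x delta r : 0 < delta -> x ^+ 2 / (2 * v) < r ->
  \forall N \near \oo,
    ((expR (- (gamma N * r)))%:E <= P [set w | `|G N w - x| < delta]%R)%E.
Proof.
move=> delta0 xr; pose lambda := x / v; pose s := r - x ^+ 2 / (2 * v).
have s0 : 0 < s by rewrite subr_gt0.
pose dl := Num.min delta (Num.min v (s / (`|lambda| + 1))).
have l0 : 0 < `|lambda| + 1 by rewrite ltr_wpDl.
have dl0 : 0 < dl by rewrite !lt_min delta0 v0/= divr_gt0.
have dldelta : dl <= delta by rewrite ge_min lexx.
have dlv : dl <= v by rewrite !ge_min lexx orbT.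
have dls : `|lambda| * dl + dl <= s.
  rewrite -[X in _ + X]mul1r -mulrDl mulrC -ler_pdivlMr//.
  by rewrite !ge_min lexx !orbT.
pose eta := dl / v; have eta0 : 0 < eta by rewrite divr_gt0.
pose e := dl ^+ 2 / (8 * v).
have e0 : 0 < e by rewrite divr_gt0 ?exprn_gt0 ?mulr_gt0.
have edl : 2 * e <= dl.
  rewrite /e mulrA ler_pdivrMr ?mulr_gt0//; nra.
have gbig : \forall N \near \oo, e^-1 * 4 < gamma N by have /cvgryPgt := goo; exact.
near=> N.
have gN4 : e^-1 * 4 < gamma N by near: N.
have gN : 0 < gamma N by apply: lt_trans gN4; rewrite mulr_gt0 ?invr_gt0.
have ge4 : 4 < gamma N * e by rewrite -ltr_pdivrMr// mulrC.
have [lo up] : ((expR (gamma N * (lambda ^+ 2 * v / 2 - e)))%:E <= mgf N lambda /\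
   mgf N lambda <= (expR (gamma N * (lambda ^+ 2 * v / 2 + e)))%:E)%E.
  by near: N; exact: mgf_bounds.
have [_ upp] : ((expR (gamma N * ((lambda + eta) ^+ 2 * v / 2 - e)))%:E <= mgf N (lambda + eta) /\
   mgf N (lambda + eta) <= (expR (gamma N * ((lambda + eta) ^+ 2 * v / 2 + e)))%:E)%E.
  by near: N; exact: mgf_bounds.
have [_ upm] : ((expR (gamma N * ((lambda - eta) ^+ 2 * v / 2 - e)))%:E <= mgf N (lambda - eta) /\
   mgf N (lambda - eta) <= (expR (gamma N * ((lambda - eta) ^+ 2 * v / 2 + e)))%:E)%E.
  by near: N; exact: mgf_bounds.
set E := lambda ^+ 2 * v / 2 - 3 * e.
have vn0 : v != 0 by exact: lt0r_neq0.
have tp : ((expR (- (gamma N * eta * (x + dl))))%:E * mgf N (lambda + eta) <= (expR (gamma N * E))%:E)%E.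
  apply: le_trans (lee_wpmul2l _ upp) _; first by rewrite lee_fin expR_ge0.
  rewrite -EFinM -expRD lee_fin ler_expR le_eqVlt; apply/orP; left; apply/eqP.
  by rewrite /E /eta /e /lambda; field.
have tm : ((expR (gamma N * eta * (x - dl)))%:E * mgf N (lambda - eta) <= (expR (gamma N * E))%:E)%E.
  apply: le_trans (lee_wpmul2l _ upm) _; first by rewrite lee_fin expR_ge0.
  rewrite -EFinM -expRD lee_fin ler_expR le_eqVlt; apply/orP; left; apply/eqP.
  by rewrite /E /eta /e /lambda; field.
have mB := measurable_dist_lt (G N) (mG N) x dl.
apply: (@le_trans _ _ (P [set w | `|G N w - x| < dl]%R)); last first.
  apply: le_measure; rewrite ?inE//; first exact: measurable_dist_lt.
  by move=> w /= /lt_le_trans; exact.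
have := le_trans lo (le_trans (lower_integrated _ x dl _ gN eta0) (leeD2l _ (leeD tp tm))).
rewrite -(@fineK _ (P _)) ?fin_num_measure// -EFinM -!EFinD !lee_fin.
set p := fine _.
have EE : expR (gamma N * E) = expR (gamma N * (lambda ^+ 2 * v / 2 - e)) * expR (- (2 * (gamma N * e))).
  by rewrite -expRD; congr expR; rewrite /E; ring.
set a := expR (gamma N * (lambda ^+ 2 * v / 2 - e)) in EE *.
have a0 : 0 < a by exact: expR_gt0.
have e8 : expR (- (2 * (gamma N * e))) <= 4^-1.
  rewrite expRN lef_pV2 ?posrE ?expR_gt0//.
  by apply: le_trans (expR_ge1Dx _); lra.
have e2 : expR (- (gamma N * e)) <= 2^-1.
  rewrite expRN lef_pV2 ?posrE ?expR_gt0//.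
  by apply: le_trans (expR_ge1Dx _); lra.
rewrite EE => h.
have {}h : a * expR (- (gamma N * e)) <= expR (gamma N * (x / v * x + `|x / v| * dl)) * p by nra.
rewrite -(ler_pM2l (expR_gt0 (gamma N * (x / v * x + `|x / v| * dl)))).
apply: le_trans h; rewrite /a -!expRD ler_expR -!mulrN -!mulrDr ler_pM2l//.
have Q1 : lambda ^+ 2 * v / 2 = x ^+ 2 / (2 * v) by rewrite /lambda; field.
have Q2 : x / v * x = x ^+ 2 / (2 * v) + x ^+ 2 / (2 * v) by field.
rewrite -/lambda in Q2 *; rewrite Q1 Q2; move: edl dls; rewrite /e /s.
set u := (8 * v)^-1; set y := x ^+ 2 / _ => edl dls; lra.
Unshelve. all: by end_near. Qed.

End gaussian_gartner_ellis.

(** * Passing to the logarithm *)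

Lemma le_exp_bounds_near (R : realType) (gamma : nat -> R) (c r s : R) :
  gamma @ \oo --> +oo -> r < s ->
  \forall N \near \oo, c * expR (- (gamma N * s)) <= expR (- (gamma N * r)).
Proof.
move=> goo rs; have sr : 0 < s - r by rewrite subr_gt0.
have h : \forall N \near \oo, (s - r)^-1 * c < gamma N by have /cvgryPgt := goo; exact.
near=> N.
have hN : (s - r)^-1 * c < gamma N by near: N.
rewrite (_ : expR (- (gamma N * r)) = expR (gamma N * (s - r)) * expR (- (gamma N * s))).
  rewrite ler_wpM2r ?expR_ge0//; apply: le_trans (expR_ge1Dx _).
  by rewrite ltr_pdivrMl// mulrC in hN; rewrite (le_trans (ltW hN))// lerDr.
by rewrite -expRD; congr expR; ring.
Unshelve. all: by end_near. Qed.

Section log_perturbation.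
Context {R : realType}.
Implicit Types k x g : R.

Lemma log_perturb_le k g : 0 < k -> 0 < 1 + g / k -> k * ln (1 + g / k) <= g.
Proof.
move=> k0 gk0; rewrite mulrC -ler_pdivlMr// -ler_expR lnK//.
exact: expR_ge1Dx.
Qed.

Lemma log_perturb_ge k g : 0 < k -> - 2^-1 <= g / k ->
  g - 2 * g ^+ 2 / k <= k * ln (1 + g / k).
Proof.
move=> k0 gk; apply: (@le_trans _ _ (k * (g / k - 2 * (g / k) ^+ 2))); last first.
  by rewrite ler_wpM2l ?ln1D_ge// ltW.
rewrite le_eqVlt; apply/orP; left; apply/eqP; field; exact: lt0r_neq0.
Qed.

End log_perturbation.

Section log_transfer.
Context {d : measure_display} {T : measurableType d} {R : realType}.
Variable P : probability T R.
Variables (G H W : nat -> T -> R) (D : nat -> set T) (gamma k : nat -> R) (v : R).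
Hypothesis mG : forall N, measurable_fun setT (G N).
Hypothesis mW : forall N, measurable_fun setT (W N).
Hypothesis mD : forall N, measurable (D N).
Hypothesis goo : gamma @ \oo --> +oo.
Hypothesis koo : k @ \oo --> +oo.
Hypothesis v0 : 0 < v.
Hypothesis GH : forall N w, ~ D N w -> G N w = H N w.
Hypothesis H1 : forall N w, 0 < k N -> 0 < 1 + H N w / k N.
Hypothesis WH : forall N w, W N w = k N * ln (1 + H N w / k N).
Hypothesis D_small : forall M, \forall N \near \oo,
  (P (D N) <= (expR (- (gamma N * M)))%:E)%E.
Hypothesis mgf_bounds : forall lambda e : R, 0 < e -> \forall N \near \oo,
  ((expR (gamma N * (lambda ^+ 2 * v / 2 - e)))%:E <=
     \int[P]_w (expR (lambda * gamma N * G N w))%:E /\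
   \int[P]_w (expR (lambda * gamma N * G N w))%:E <=
     (expR (gamma N * (lambda ^+ 2 * v / 2 + e)))%:E)%E.

Let WH_close K delta : 0 < K -> 0 < delta -> \forall N \near \oo, forall w,
  `|H N w| <= K -> `|W N w - H N w| <= delta.
Proof.
move=> K0 delta0.
have kbig : \forall N \near \oo, Num.max (2 * K) (2 * K ^+ 2 / delta) < k N.
  by have /cvgryPgt := koo; exact.
near=> N.
have : Num.max (2 * K) (2 * K ^+ 2 / delta) < k N by near: N.
rewrite gt_max => /andP[k1 k2] w HK.
have k0 : 0 < k N by apply: lt_trans k1; rewrite mulr_gt0.
have up := log_perturb_le _ _ k0 (H1 _ w k0).
have lo : H N w - 2 * H N w ^+ 2 / k N <= W N w.
  rewrite WH; apply: log_perturb_ge => //.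
  rewrite ler_pdivlMr//; move: HK; rewrite ler_norml => /andP[h1 h2]; lra.
rewrite -WH in up; rewrite distrC ger0_norm ?subr_ge0// lerBlDr -lerBlDl.
apply: le_trans lo; rewrite lerD2l lerN2 ler_pdivrMr//.
have HK2 : H N w ^+ 2 <= K ^+ 2.
  by rewrite -(real_normK (num_real (H N w))) lerXn2r ?nnegrE// ltW.
by move: k2; rewrite ltr_pdivrMr//; lra.
Unshelve. all: by end_near. Qed.

Lemma log_transfer_lower x delta r : 0 < delta -> x ^+ 2 / (2 * v) < r ->
  \forall N \near \oo,
    ((expR (- (gamma N * r)))%:E <= P [set w | `|W N w - x| < delta]%R)%E.
Proof.
move=> delta0 xr; pose r1 := (x ^+ 2 / (2 * v) + r) / 2.
have xr1 : x ^+ 2 / (2 * v) < r1 by rewrite midf_lt.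
have r1r : r1 < r by rewrite midf_lt.
have d20 : 0 < delta / 2 by rewrite divr_gt0.
near=> N.
have lo : ((expR (- (gamma N * r1)))%:E <= P [set w | `|G N w - x| < delta / 2]%R)%E.
  by near: N; exact: (gartner_ellis_lower _ _ _ _ mG goo v0 mgf_bounds).
have Dr : (P (D N) <= (expR (- (gamma N * r)))%:E)%E by near: N; exact: D_small.
have cl w : `|H N w| <= `|x| + delta -> `|W N w - H N w| <= delta / 2.
  by move: w; near: N; apply: WH_close => //; rewrite ltr_wpDl.
have e2 : 2 * expR (- (gamma N * r)) <= expR (- (gamma N * r1)).
  by near: N; exact: le_exp_bounds_near.
have sub : [set w | `|G N w - x| < delta / 2] `<=` [set w | `|W N w - x| < delta] `|` D N.
  move=> w /= Gx; have [Dw|Dw] := pselect (D N w); [by right|left].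
  rewrite (GH _ _ Dw) in Gx; rewrite -(subrK (H N w) (W N w)) -addrA.
  rewrite (le_lt_trans (ler_normD _ _))// [ltRHS](splitr delta).
  rewrite ler_ltD// cl// -[X in `|X|](subrK x) (le_trans (ler_normD _ _))//.
  by rewrite addrC lerD2l ltW// (lt_trans Gx)// [ltRHS](splitr delta) ltrDl.
have U : (P ([set w | `|W N w - x| < delta]%R `|` D N) <=
    P [set w | `|W N w - x| < delta]%R + P (D N))%E.
  by apply: measureU2 => //; exact: measurable_dist_lt.
have le2 : (P [set w | `|G N w - x| < delta / 2]%R <=
    P ([set w | `|W N w - x| < delta]%R `|` D N))%E.
  by apply: le_measure => //; rewrite inE;
    [exact: measurable_dist_lt|apply: measurableU => //; exact: measurable_dist_lt].
have := le_trans lo (le_trans le2 (le_trans U (leeD2l _ Dr))).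
rewrite -(@fineK _ (P [set w | `|W N w - x| < delta])) ?fin_num_measure//; last exact: measurable_dist_lt.
rewrite -EFinD !lee_fin; lra.
Unshelve. all: by end_near. Qed.

Lemma log_transfer_upper rho r : 0 < rho -> r < rho ^+ 2 / (2 * v) ->
  \forall N \near \oo,
    (P [set w | rho <= `|W N w|]%R <= (expR (- (gamma N * r)))%:E)%E.
Proof.
move=> rho0 rr; pose gap := rho ^+ 2 / (2 * v) - r.
have gap0 : 0 < gap by rewrite subr_gt0.
pose s := Num.min (rho / 2) (gap * v / (2 * rho)).
have s0 : 0 < s by rewrite lt_min !divr_gt0 ?mulr_gt0.
have srho : s <= rho / 2 by rewrite ge_min lexx.
have sgap : rho * s / v <= gap / 2.
  rewrite ler_pdivrMr//; have : s <= gap * v / (2 * rho) by rewrite ge_min lexx orbT.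
  rewrite ler_pdivlMr ?mulr_gt0//; lra.
pose rho' := rho - s.
have rho'0 : 0 < rho' by rewrite /rho'; lra.
pose r' := r + gap / 4.
have r'r : r < r' by rewrite ltrDl divr_gt0.
have rr' : r' < rho' ^+ 2 / (2 * v).
  rewrite /r'; apply: (@lt_le_trans _ _ (rho ^+ 2 / (2 * v) - rho * s / v)).
    by rewrite /gap in sgap gap0 *; lra.
  rewrite (_ : _ - _ = (rho ^+ 2 - 2 * rho * s) / (2 * v)); last by field; exact: lt0r_neq0.
  rewrite ler_pM2r ?invr_gt0 ?mulr_gt0// /rho'; have := sqr_ge0 s; nra.
have rrN : r' < (- rho') ^+ 2 / (2 * v) by rewrite sqrrN.
near=> N.
have U1 : (P [set w | rho' ^+ 2 <= rho' * G N w]%R <= (expR (- (gamma N * r')))%:E)%E.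
  by near: N; exact: (gartner_ellis_upper _ _ _ _ mG goo v0 mgf_bounds).
have U2 : (P [set w | (- rho') ^+ 2 <= (- rho') * G N w]%R <= (expR (- (gamma N * r')))%:E)%E.
  by near: N; exact: (gartner_ellis_upper _ _ _ _ mG goo v0 mgf_bounds).
have U3 : (P (D N) <= (expR (- (gamma N * r')))%:E)%E by near: N; exact: D_small.
have e3 : 3 * expR (- (gamma N * r')) <= expR (- (gamma N * r)).
  by near: N; exact: le_exp_bounds_near.
have cl w : `|H N w| <= rho -> `|W N w - H N w| <= s.
  by move: w; near: N; exact: WH_close.
have k0 : 0 < k N by near: N; have /cvgryPgt := koo; exact.
have mlin := measurable_le_scale (G N) (mG N).
have sub : [set w | rho <= `|W N w|] `<=`
    ([set w | rho' ^+ 2 <= rho' * G N w] `|`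
     [set w | (- rho') ^+ 2 <= (- rho') * G N w]) `|` D N.
  move=> w /= Wr; have [Dw|Dw] := pselect (D N w); [by right|left].
  rewrite (GH _ _ Dw).
  have up : W N w <= H N w by rewrite WH log_perturb_le// H1.
  move: Wr; rewrite ler_normr => /orP[Wr|Wr]; [left|right].
    by rewrite expr2 ler_pM2l// (le_trans _ up)// (le_trans _ Wr)// /rho'; lra.
  rewrite sqrrN mulNr -mulrN expr2 ler_pM2l// lerNr leNgt; apply/negP => Hr.
  have H0 : H N w < 0.
    rewrite ltNge; apply/negP => H0.
    have : 0 <= W N w.
      rewrite WH mulr_ge0 ?(ltW k0)//; apply: ln_ge0.
      by rewrite lerDl divr_ge0 ?(ltW k0).
    by rewrite leNgt => /negP; apply; lra.
  have : `|H N w| <= rho by rewrite ltr0_norm//; rewrite /rho' in Hr; lra.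
  move=> /cl; rewrite ler_norml => /andP[+ _]; rewrite /rho' in Hr; lra.
apply: (@le_trans _ _ (P (([set w | rho' ^+ 2 <= rho' * G N w]%R `|`
     [set w | (- rho') ^+ 2 <= (- rho') * G N w]%R) `|` D N))).
  apply: le_measure => //; rewrite inE; last by do 2 ?apply: measurableU.
  exact: measurable_le_norm.
apply: le_trans (measureU2 _ _ _) _ => //; first exact: measurableU.
apply: le_trans (leeD (measureU2 _ _ _) U3) _ => //.
apply: le_trans (leeD (leeD U1 U2) (le_refl _)) _.
by rewrite -!EFinD lee_fin; lra.
Unshelve. all: by end_near. Qed.

End log_transfer.

(** * Large deviation principles from exponential bounds *)

Section rate_functions.
Context {R : realType}.

Definition quadratic_rate (v x : R) : \bar R := (x ^+ 2 / (2 * v))%:E.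

Definition point_rate (x : R) : \bar R := if x == 0 then 0%E else +oo%E.

Lemma quadratic_rate_lsc v : lower_semicontinuous (quadratic_rate v).
Proof.
apply/lower_semicontinuousP => a.
rewrite (_ : [set x | _] = (fun x : R => x ^+ 2 / (2 * v)) @^-1` [set y | y > a]); last first.
  by apply/seteqP; split=> x /=; rewrite /quadratic_rate lte_fin.
apply: open_comp; last exact: open_gt.
by move=> x _; apply: cvgM; [exact: sqr_continuous|exact: cvg_cst].
Qed.

Lemma quadratic_rate_good v : 0 < v -> good_rate_function (quadratic_rate v).
Proof.
move=> v0 c.
apply: (@subclosed_compact _ _ `[- (1 + `|c| * (2 * v)), 1 + `|c| * (2 * v)]).
- rewrite (_ : [set x | _] = (fun x : R => x ^+ 2 / (2 * v)) @^-1` [set y | y <= c]); last first.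
    by apply/seteqP; split=> x /=; rewrite /quadratic_rate lee_fin.
  apply: closed_comp; last exact: closed_le.
  by move=> x _; apply: cvgM; [exact: sqr_continuous|exact: cvg_cst].
- exact: segment_compact.
- move=> x /=; rewrite /quadratic_rate lee_fin in_itv/= -ler_norml => xc.
  have xc2 : x ^+ 2 <= `|c| * (2 * v).
    by rewrite -ler_pdivrMr ?mulr_gt0// (le_trans xc)// ler_norm.
  have := normr_ge0 x; rewrite -(real_normK (num_real x)) in xc2; nra.
Qed.

Lemma point_rate_lsc : lower_semicontinuous point_rate.
Proof.
apply/lower_semicontinuousP => a; have [a0|a0] := ltP a 0.
  rewrite (_ : [set x | _] = setT); first exact: openT.
  apply/seteqP; split=> x //= _; rewrite /point_rate; case: ifPn => _.
    by rewrite lte_fin.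
  exact: ltry.
rewrite (_ : [set x | _] = ~` [set 0 : R]).
  by apply: closed_openC; exact: closed_eq.
apply/seteqP; split=> x /=; rewrite /point_rate.
  by move=> + x0; rewrite x0 eqxx lte_fin ltNge a0.
by move=> /eqP/negbTE ->; exact: ltry.
Qed.

Lemma point_rate_good : good_rate_function point_rate.
Proof.
move=> c; apply: (@subclosed_compact _ _ [set 0 : R]).
- rewrite -openC (_ : ~` _ = [set x | (c%:E < point_rate x)%E]).
    by move/lower_semicontinuousP : point_rate_lsc; exact.
  by apply/seteqP; split=> x /=; [move/negP; rewrite -ltNge|rewrite ltNge => /negP].
- exact: compact_set1.
- by move=> x /=; rewrite /point_rate; case: eqP => // _; rewrite leye_eq.
Qed.

End rate_functions.

Section ldp_criteria.
Context {d : measure_display} {T : measurableType d} {R : realType}.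
Variable P : probability T R.
Variables (W : nat -> {RV P >-> R}) (gamma : nat -> R).
Hypothesis goo : gamma @ \oo --> +oo.

Let trivial_upper (A : set R) (r : R) : measurable A -> r < 0 ->
  \forall N \near \oo, (P (W N @^-1` A) <= (expR (- (gamma N * r)))%:E)%E.
Proof.
move=> mA r0; near=> N.
have gN : 0 < gamma N by near: N; have /cvgryPgt := goo; exact.
apply: le_trans (probability_le1 _ _) _.
  by rewrite -[X in measurable X]setTI; exact: measurable_funP.
by rewrite lee_fin -mulrN -[leLHS]expR0 ler_expR mulr_ge0 ?oppr_ge0 ?ltW.
Unshelve. all: by end_near. Qed.

Let upper_of_subset (A : set R) (r rho : R) : measurable A ->
  (forall x, A x -> rho <= `|x|) ->
  (\forall N \near \oo,
    (P [set w | rho <= `|W N w|]%R <= (expR (- (gamma N * r)))%:E)%E) ->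
  \forall N \near \oo, (P (W N @^-1` A) <= (expR (- (gamma N * r)))%:E)%E.
Proof.
move=> mA Arho; apply: filterS => N; apply: le_trans.
apply: le_measure; rewrite ?inE.
- by rewrite -[X in measurable X]setTI; exact: measurable_funP.
- exact: measurable_le_norm.
- by move=> w /= /Arho.
Qed.

Lemma ldp_quadratic v : 0 < v ->
  (forall rho r : R, 0 < rho -> r < rho ^+ 2 / (2 * v) ->
    \forall N \near \oo,
      (P [set w | rho <= `|W N w|]%R <= (expR (- (gamma N * r)))%:E)%E) ->
  (forall x delta r : R, 0 < delta -> x ^+ 2 / (2 * v) < r ->
    \forall N \near \oo,
      ((expR (- (gamma N * r)))%:E <= P [set w | `|W N w - x| < delta]%R)%E) ->
  ldp W gamma (quadratic_rate v).
Proof.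
move=> v0 up lo; apply: ldp_of_exp_bounds => //.
- by move=> x; rewrite lee_fin divr_ge0 ?sqr_ge0// mulr_ge0// ltW.
- exact: quadratic_rate_lsc.
- move=> A r s mA rs As; have [r0|r0] := ltP r 0; first exact: trivial_upper.
  have s0 : 0 < s by exact: le_lt_trans rs.
  have v2 : 0 < 2 * v by rewrite mulr_gt0.
  apply: (@upper_of_subset _ _ (Num.sqrt (s * (2 * v)))) => //.
    move=> x Ax; have := As x (subset_closure Ax).
    rewrite lee_fin ler_pdivlMr// => sx.
    by rewrite -sqrtr_sqr ler_wsqrtr.
  apply: up; first by rewrite sqrtr_gt0 mulr_gt0.
  by rewrite sqr_sqrtr ?mulfK ?lt0r_neq0// mulr_ge0 ?ltW.
- move=> x delta r delta0; rewrite lte_fin => xr.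
  have := lo x delta r delta0 xr; apply: filterS => N.
  by rewrite (_ : [set w | _] = W N @^-1` ball x delta)//;
    apply/seteqP; split=> w /=; rewrite /ball/= distrC.
Qed.

Lemma ldp_point :
  (forall rho r : R, 0 < rho ->
    \forall N \near \oo,
      (P [set w | rho <= `|W N w|]%R <= (expR (- (gamma N * r)))%:E)%E) ->
  ldp W gamma point_rate.
Proof.
move=> up; apply: ldp_of_exp_bounds => //.
- by move=> x; rewrite /point_rate; case: ifP.
- exact: point_rate_lsc.
- move=> A r s mA rs As; have [r0|r0] := ltP r 0; first exact: trivial_upper.
  have s0 : 0 < s by exact: le_lt_trans rs.
  have : ~ closure A 0 by move=> /As; rewrite /point_rate eqxx lee_fin leNgt s0.
  move=> /existsNP[B] /not_implyP[/nbhs_ballP[rho /= rho0 rhoB] AB].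
  apply: (@upper_of_subset _ _ rho) => //; last exact: up.
  move=> x Ax; rewrite leNgt; apply/negP => xrho; apply: AB; exists x; split => //.
  by apply: rhoB; rewrite /ball/= sub0r normrN.
- move=> x delta r delta0; rewrite /point_rate; case: eqP => // -> ; rewrite lte_fin => r0.
  have h := up delta r delta0; have e2 := le_exp_bounds_near _ _ 2 _ _ goo r0.
  near=> N.
  have hN : (P [set w | delta <= `|W N w|]%R <= (expR (- (gamma N * r)))%:E)%E by near: N.
  have := e2; have e2N : 2 * expR (- (gamma N * r)) <= expR (- (gamma N * 0)) by near: N.
  move=> _; rewrite mulr0 oppr0 expR0 in e2N.
  have -> : W N @^-1` ball 0 delta = ~` [set w | delta <= `|W N w|].
    by apply/seteqP; split=> w /=; rewrite /ball/= sub0r normrN ltNge => /negP.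
  have mN : measurable [set w | delta <= `|W N w|] by exact: measurable_le_norm.
  rewrite probability_setC//; move: hN.
  rewrite -(@fineK _ (P [set w | delta <= `|W N w|])) ?fin_num_measure//.
  rewrite -EFinB !lee_fin; lra.
Unshelve. all: by end_near. Qed.

End ldp_criteria.

(** * Products of independent random variables *)

Section weighted_pushforward.
Context {d1 d2 : measure_display} {T1 : measurableType d1} {T2 : measurableType d2}.
Context {R : realType}.
Variables (m1 : {measure set T1 -> \bar R}) (m2 : {measure set T2 -> \bar R}).
Variables (phi : T2 -> T1) (rho : T2 -> R).
Hypothesis mphi : measurable_fun setT phi.
Hypothesis mrho : measurable_fun setT rho.
Hypothesis rho0 : forall y, 0 <= rho y.
Hypothesis m12 : forall A, measurable A ->
  m1 A = (\int[m2]_y (\1_A (phi y) * rho y)%:E)%E.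
Local Open Scope ereal_scope.

Import HBNNSimple.

Let integral_nnsfun (f : {nnsfun T1 >-> R}) :
  \int[m1]_x (f x)%:E = \int[m2]_y (f (phi y) * rho y)%:E.
Proof.
have mphiE (g : T1 -> R) : measurable_fun setT g -> measurable_fun setT (g \o phi).
  by move=> mg; exact: measurableT_comp.
under [LHS]eq_integral do rewrite fimfunE -fsumEFin//.
rewrite [LHS]ge0_integral_fsum//; last 2 first.
  - by move=> r; exact/measurable_EFinP/measurableT_comp.
  - by move=> n x _; rewrite EFinM nnfun_muleindic_ge0.
under [RHS]eq_integral.
  move=> y _; rewrite fimfunE EFinM -fsumEFin// ge0_mule_fsuml; last first.
    by move=> r; rewrite EFinM nnfun_muleindic_ge0.
  over.
have mind r : measurable_fun [set: T2] (fun y => (\1_(f @^-1` [set r]) (phi y) * rho y)%R).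
  by apply: measurable_funM => //; apply: mphiE; exact: measurable_indic.
rewrite [RHS]ge0_integral_fsum//; last 2 first.
  - move=> r; rewrite (_ : (fun _ => _) = (fun y => (r * (\1_(f @^-1` [set r]) (phi y) * rho y))%:E)).
      by apply/measurable_EFinP; exact: measurable_funM.
    by apply/funext => y; rewrite -EFinM mulrA.
  - move=> n x _; apply: mule_ge0; last by rewrite lee_fin.
    by rewrite EFinM nnfun_muleindic_ge0.
apply: eq_fsbigr => r rf.
rewrite integralZl_indic_nnsfun//= integral_indic// setIT m12//.
have r0 : (0 <= r)%R by move: rf; rewrite inE => -[x _ <-].
rewrite -ge0_integralZl//.
- by apply: eq_integral => y _; rewrite -!EFinM mulrA.
- exact/measurable_EFinP.
- by move=> y _; rewrite lee_fin mulr_ge0.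
Qed.

Lemma ge0_integral_weighted_pushforward (f : T1 -> R) :
  measurable_fun [set: T1] f -> (forall x, (0 <= f x)%R) ->
  \int[m1]_x (f x)%:E = \int[m2]_y (f (phi y) * rho y)%:E.
Proof.
move=> mf f0; have mEf : measurable_fun setT (EFin \o f) by exact/measurable_EFinP.
have f0E x : [set: T1] x -> (0 <= (EFin \o f) x) by move=> _; rewrite lee_fin.
pose f_ := nnsfun_approx measurableT mEf.
transitivity (lim (\int[m1]_x (f_ n x)%:E @[n --> \oo])).
  rewrite -monotone_convergence//=.
  - apply: eq_integral => x _; apply/esym/cvg_lim => //=.
    exact: (cvg_nnsfun_approx _ mEf f0E).
  - by move=> n; exact/measurable_EFinP/measurable_funTS.
  - by move=> n ? _; rewrite lee_fin.
  - by move=> ? _ ? ? mn; rewrite lee_fin; exact/lefP/nd_nnsfun_approx.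
transitivity (lim (\int[m2]_y (f_ n (phi y) * rho y)%:E @[n --> \oo])).
  by apply: congr_lim; apply/funext => n; exact: integral_nnsfun.
rewrite -monotone_convergence//=.
- apply: eq_integral => y _; apply/cvg_lim => //=.
  under eq_fun do rewrite EFinM.
  rewrite EFinM; apply: cvgeZr => //.
  exact: (cvg_nnsfun_approx _ mEf f0E).
- by move=> n; apply/measurable_EFinP; apply: measurable_funM => //; exact: measurableT_comp.
- by move=> n ? _; rewrite lee_fin mulr_ge0.
- move=> y _ a b ab; rewrite lee_fin ler_wpM2r//; exact/lefP/nd_nnsfun_approx.
Qed.

End weighted_pushforward.

Section independent_products.
Context {d : measure_display} {T : measurableType d} {R : realType}.
Variable P : probability T R.
Variables (I : choiceType) (X : I -> {RV P >-> R}) (f : I -> R -> R).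
Hypothesis indepX : mutually_independent X.
Hypothesis mf : forall i, measurable_fun setT (f i).
Hypothesis f0 : forall i x, 0 <= f i x.
Hypothesis fin : forall i, (\int[P]_w (f i (X i w))%:E < +oo)%E.

Let integral_prod_indic (A : I -> set R) (s : seq I) : uniq s ->
  (forall i, measurable (A i)) ->
  (\int[P]_w (\prod_(i <- s) \1_(A i) (X i w))%:E = \prod_(i <- s) P (X i @^-1` A i))%E.
Proof.
move=> us mA; have sf : perm_eq s (enum_fset [fset i in s]%fset).
  by apply: uniq_perm => // i; rewrite in_fset.
transitivity (P (\bigcap_(i in [set` [fset i in s]%fset]) (X i @^-1` A i))).
  rewrite -[X in P X]setIT -integral_indic//; last first.
    apply: fin_bigcap_measurable => // i _.
    by rewrite -[X in measurable X]setTI; exact: measurable_funP.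
  apply: eq_integral => w _; congr EFin; rewrite [RHS]indicE.
  have [sA|sA] := boolP (all (fun i => w \in X i @^-1` A i) s).
    rewrite mem_set; last first.
      move=> i; rewrite /= in_fset => is_; apply: set_mem; exact: (allP sA).
    rewrite big_seq big1// => i is_; rewrite indicE mem_set//.
    by have := allP sA i is_; rewrite inE.
  move/allPn : sA => [i is_ /negP iA]; rewrite memNset.
    rewrite (big_rem i)//= indicE memNset ?mul0r// => Ai.
    by apply: iA; rewrite inE.
  by move=> h; apply: iA; rewrite inE; apply: h; rewrite /= in_fset.
by rewrite indepX// (perm_big _ sf).
Qed.

Lemma expectation_prod_independent (s : seq I) : uniq s ->
  (\int[P]_w (\prod_(i <- s) f i (X i w))%:E =
   \prod_(i <- s) \int[P]_w (f i (X i w))%:E)%E.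
Proof.
pose e i := fine (\int[P]_w (f i (X i w))%:E)%E.
have int0 i : (0 <= \int[P]_w (f i (X i w))%:E)%E.
  by apply: integral_ge0 => w _; rewrite lee_fin.
have eE i : (\int[P]_w (f i (X i w))%:E = (e i)%:E)%E by rewrite fineK// ge0_fin_numE.
have e0 i : 0 <= e i by rewrite fine_ge0.
have mfX i : measurable_fun setT (fun w => f i (X i w)) by exact: measurableT_comp.
(* Replace the indicators by the functions [f i] one coordinate at a time. *)
have mix (s1 s2 : seq I) (A : I -> set R) : uniq (s1 ++ s2) -> (forall i, measurable (A i)) ->
  (\int[P]_w ((\prod_(i <- s1) f i (X i w)) * \prod_(i <- s2) \1_(A i) (X i w))%:E =
   (\prod_(i <- s1) e i)%:E * \prod_(i <- s2) P (X i @^-1` A i))%E.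
  elim: s1 s2 A => [|i s1 IH] s2 A us mA.
    rewrite big_nil mul1e -integral_prod_indic//.
    by apply: eq_integral => w _; rewrite big_nil mul1r.
  pose c := (\prod_(j <- s1) e j) * \prod_(j <- s2) fine (P (X j @^-1` A j)).
  have c0 : 0 <= c.
    by apply: mulr_ge0; apply: prodr_ge0 => // j _; rewrite fine_ge0.
  have PE : (\prod_(j <- s2) P (X j @^-1` A j) = (\prod_(j <- s2) fine (P (X j @^-1` A j)))%:E)%E.
    rewrite -prodEFin; apply: eq_bigr => j _; rewrite fineK// fin_num_measure//.
    by rewrite -[X in measurable X]setTI; exact: measurable_funP.
  rewrite PE big_cons -EFinM -mulrA -/c.
  pose rho w := (\prod_(j <- s1) f j (X j w)) * \prod_(j <- s2) \1_(A j) (X j w).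
  have mrho : measurable_fun setT rho.
    have mI j : measurable_fun setT (\1_(A j) \o X j : T -> R).
      by apply: measurableT_comp => //; exact: measurable_indic.
    apply: measurable_funM; first exact: measurable_prod.
    by apply: (measurable_prod (h := fun j w => \1_(A j) (X j w))) => j _; exact: mI.
  have rho0 w : 0 <= rho w.
    by apply: mulr_ge0; apply: prodr_ge0 => // j _; rewrite indicE.
  have h : forall B, measurable B ->
    mscale (NngNum c0) (distribution P (X i)) B = (\int[P]_w (\1_B (X i w) * rho w)%:E)%E.
    move=> B mB; pose A' j := if j == i then B else A j.
    have mA' j : measurable (A' j) by rewrite /A'; case: ifP.
    have us' : uniq (s1 ++ i :: s2).
      by rewrite (perm_uniq (s2 := (i :: s1) ++ s2))// -cat1s -[in X in perm_eq _ X]cat1s perm_catCA.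
    have is2 : i \notin s2.
      by move: us' ; rewrite cat_uniq => /and3P[_ _ /=] /andP[].
    have A's2 j : j \in s2 -> A' j = A j.
      by move=> js2; rewrite /A'; case: eqP => // ji; rewrite -ji js2 in is2.
    have A'i : A' i = B by rewrite /A' eqxx.
    have PA' : (\prod_(j <- s2) P (X j @^-1` A' j) = \prod_(j <- s2) P (X j @^-1` A j))%E.
      by rewrite big_seq [RHS]big_seq; apply: eq_bigr => j js2; rewrite (A's2 _ js2).
    have := IH (i :: s2) A' us' mA'; rewrite big_cons A'i PA' PE /mscale/= => IHi.
    transitivity ((\prod_(i <- s1) e i)%:E * (P (X i @^-1` B) * (\prod_(j <- s2) fine (P (X j @^-1` A j)))%:E))%E.
      by rewrite /c EFinM /distribution /pushforward -muleA [in RHS](muleC (P _)).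
    rewrite -IHi; apply: eq_integral => w _; congr EFin.
    rewrite big_cons A'i /rho mulrCA; congr (_ * (_ * _)).
    by rewrite big_seq [RHS]big_seq; apply: eq_bigr => j js2; rewrite (A's2 _ js2).
  have := ge0_integral_weighted_pushforward _ _ _ _ (measurable_funP (X i)) mrho rho0 h _ (mf i) (f0 i).
  rewrite ge0_integral_mscale//; last 2 first.
    by apply/measurable_EFinP.
    by move=> x _; rewrite lee_fin.
  rewrite ge0_integral_distribution//; last 2 first.
    by apply/measurable_EFinP.
    by move=> x; rewrite lee_fin.
  rewrite /= eE -EFinM mulrC => ->.
  by apply: eq_integral => w _; rewrite big_cons -mulrA.
move=> us; have := mix s [::] (fun=> setT); rewrite cats0 big_nil mule1 => /(_ us (fun=> measurableT)) h.
under [RHS]eq_bigr do rewrite eE.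
rewrite prodEFin -h; apply: eq_integral => w _.
by rewrite big_nil mulr1.
Qed.

End independent_products.

(** * Normal tails *)

Section normal_tails.
Context {R : realType}.
Implicit Types m L theta x : R.
Local Notation mu := (@lebesgue_measure R).

Lemma normal_pdf1E m x :
  normal_pdf m 1 x = normal_peak 1 * expR (- ((x - m) ^+ 2 / 2)).
Proof.
by rewrite normal_pdfE ?oner_eq0// /normal_fun expr1n mulNr.
Qed.

Lemma normal_peak1_le1 : normal_peak 1 <= 1 :> R.
Proof.
have pi2 : 1 <= pi *+ 2 :> R by have := pi_ge2 R; rewrite mulr2n; lra.
rewrite /normal_peak expr1n mul1r.
have h : 1 <= Num.sqrt (pi *+ 2) :> R by rewrite -[leLHS]sqrtr1 ler_wsqrtr.
by rewrite invf_le1// (lt_le_trans ltr01 h).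
Qed.

Lemma normal_pdf_tilt theta x :
  expR (theta * x) * normal_pdf 0 1 x = expR (theta ^+ 2 / 2) * normal_pdf theta 1 x.
Proof.
rewrite !normal_pdf1E mulrCA [RHS]mulrCA; congr (_ * _).
by rewrite -!expRD; congr expR; field.
Qed.

Lemma normal_prob_indic m (A : set R) : measurable A ->
  normal_prob m 1 A = (\int[mu]_x (\1_A x * normal_pdf m 1 x)%:E)%E.
Proof.
move=> mA; rewrite /normal_prob integral_mkcond; apply: eq_integral => x _.
by rewrite patchE indicE; case: ifPn => _; rewrite ?mul1r ?mul0r.
Qed.

(* On [x > L] the density is at most [(x - m) / (L - m)] times itself, which has
   an explicit antiderivative. *)
Lemma normal_prob_tail_le m L : m < L ->
  (normal_prob m 1 `]L, +oo[%classic <= (expR (- ((L - m) ^+ 2 / 2)) / (L - m))%:E)%E.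
Proof.
move=> mL; have Lm : 0 < L - m by rewrite subr_gt0.
pose E x := expR (- ((x - m) ^+ 2 / 2)).
pose F x := - (L - m)^-1 * E x.
pose f x := (x - m) / (L - m) * E x.
have dF x : is_derive x 1 F (f x).
  rewrite /F /f /E; apply: is_derive_eq.
  rewrite /GRing.scale/=; field; exact: lt0r_neq0.
have cf : continuous f.
  move=> x; rewrite /f; apply: cvgM.
    apply: cvgM; last exact: cvg_cst.
    by apply: cvgB; [exact: cvg_id|exact: cvg_cst].
  apply: (cvg_comp _ expR); last exact: continuous_expR.
  apply: cvgN; apply: cvgM; last exact: cvg_cst.
  apply: (cvg_comp (fun x => x - m) (fun x => x ^+ 2)); last exact: sqr_continuous.
  by apply: cvgB; [exact: cvg_id|exact: cvg_cst].
have Fy : F x @[x --> +oo] --> (0 : R).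
  apply/cvgrPdist_le => e e0; near=> x.
  have x1 : m + Num.max 1 ((L - m)^-1 / e) < x by near: x; apply: nbhs_pinfty_gt; rewrite num_real.
  have : Num.max 1 ((L - m)^-1 / e) < x - m by rewrite ltrBrDl.
  rewrite gt_max => /andP[xm1 xm2]; set y := x - m in xm1 xm2 *.
  have y0 : 0 < y by apply: lt_trans xm1.
  rewrite sub0r normrN /F normrM normrN !gtr0_norm ?invr_gt0 ?expR_gt0//.
  apply: (@le_trans _ _ ((L - m)^-1 * y^-1)).
    rewrite ler_wpM2l ?invr_ge0 ?(ltW Lm)// /E -/y expRN lef_pV2 ?posrE ?expR_gt0//.
    by apply: le_trans (expR_ge1Dx _); have := sqr_ge0 (y - 1); lra.
  by rewrite ler_pdivrMr// mulrC [leRHS]mulrC; move: xm2; rewrite ltr_pdivrMr// mulrC => /ltW.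
have -> : (expR (- ((L - m) ^+ 2 / 2)) / (L - m))%:E = (\int[mu]_(x in `[L, +oo[) (f x)%:E)%E.
  rewrite (@ge0_continuous_FTC2y R f F L 0) => [| | | | | |]//.
  - by rewrite sub0e -EFinN /F mulNr opprK mulrC.
  - move=> x Lx; rewrite /f mulr_ge0 ?expR_ge0// divr_ge0 ?(ltW Lm)// subr_ge0.
    exact: le_trans (ltW mL) Lx.
  - exact: continuous_subspaceT.
  - apply: cvg_at_right_filter; apply: differentiable_continuous.
    by apply/derivable1_diffP; have [] := dF L.
  - by move=> x _; rewrite derive1E; have [_ ->] := dF x.
rewrite /normal_prob integral_itv_obnd_cbnd; last first.
  by apply/measurable_EFinP/measurable_funTS; exact: measurable_normal_pdf.
apply: ge0_le_integral => //.
- by move=> x _; rewrite lee_fin normal_pdf_ge0.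
- by apply/measurable_EFinP/measurable_funTS; exact: measurable_normal_pdf.
- by apply/measurable_EFinP/measurable_funTS; exact: continuous_measurable_fun.
- move=> x; rewrite /= in_itv/= andbT => Lx; rewrite lee_fin normal_pdf1E.
  rewrite ler_wpM2r ?expR_ge0// (le_trans normal_peak1_le1)//.
  by rewrite ler_pdivlMr// mul1r lerD2r.
Unshelve. all: by end_near. Qed.

Lemma normal_prob_itvoc_le m L : L <= m ->
  (normal_prob m 1 `]L, m]%classic <= (m - L)%:E)%E.
Proof.
move=> Lm; apply: (@le_trans _ _ (\int[mu]_(x in `]L, m]) 1)%E).
  apply: ge0_le_integral => //.
  - by move=> x _; rewrite lee_fin normal_pdf_ge0.
  - by apply/measurable_EFinP/measurable_funTS; exact: measurable_normal_pdf.
  - move=> x _; rewrite lee_fin; apply: le_trans normal_peak1_le1.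
    by apply: normal_pdf_ub; rewrite oner_eq0.
rewrite integral_cst//= mul1e lebesgue_measure_itv/= lte_fin.
by case: ifPn => // ; rewrite lee_fin subr_ge0.
Qed.

Lemma normal_prob_half m : normal_prob m 1 `]-oo, m]%classic = (2^-1)%:E.
Proof.
have mpdf D : measurable_fun D (fun x => (normal_pdf m 1 x)%:E).
  by apply/measurable_EFinP/measurable_funTS; exact: measurable_normal_pdf.
have cpdf : continuous (normal_pdf m 1) by apply: continuous_normal_pdf; rewrite oner_eq0.
pose F x : R := 2 * m - x.
have dF x : is_derive x 1 F (- 1).
  rewrite /F; apply: is_derive_eq. by rewrite ?scaler0 ?scale0r /GRing.scale/=; ring.
have F'E : F^`()%classic = cst (-1).
  by apply/funext => x; rewrite derive1E; have [_ ->] := dF x.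
have half : normal_prob m 1 `]-oo, m]%classic = normal_prob m 1 `]m, +oo[%classic.
  rewrite /normal_prob [RHS]integral_itv_obnd_cbnd//.
  have Fm : F m = m by rewrite /F; ring.
  rewrite -[X in `]-oo, X]]Fm (@decreasing_ge0_integration_by_substitutiony R F (normal_pdf m 1) m).
  - apply: eq_integral => x _; congr EFin.
    rewrite F'E; change (normal_pdf m 1 (F x) * - (-1) = normal_pdf m 1 x).
    rewrite opprK mulr1 !normal_pdf1E (_ : (F x - m) ^+ 2 = (x - m) ^+ 2)//.
    by rewrite /F; ring.
  - by move=> x y _ _ xy; rewrite /F ltrD2l ltrN2.
  - by rewrite F'E => x _; exact: cvg_cst.
  - by rewrite F'E; exact: is_cvg_cst.
  - by rewrite F'E; exact: is_cvg_cst.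
  - split; first by move=> x _; have [] := dF x.
    apply: cvg_at_right_filter; apply: differentiable_continuous.
    by apply/derivable1_diffP; have [] := dF m.
  - apply/cvgrNyPle => A; near=> x; rewrite /F lerBlDl -lerBlDr.
    by near: x; apply: nbhs_pinfty_ge; rewrite num_real.
  - exact: continuous_subspaceT.
  - by move=> x _; rewrite normal_pdf_ge0.
have := probability_setC (normal_prob m 1) (measurable_itv `]-oo, m]).
have -> : ~` [set` `]-oo, m]] = `]m, +oo[%classic.
  by apply/seteqP; split=> x /=; rewrite !in_itv/= ?andbT ltNge => /negP.
move=> h; pose p := fine (normal_prob m 1 `]-oo, m]%classic).
have hp : normal_prob m 1 `]-oo, m]%classic = p%:E.
  by rewrite /p fineK// (@fin_num_measure _ _ _ (normal_prob m 1)).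
have : (p%:E = 1 - p%:E)%E by rewrite -hp {1}half; exact: h.
by rewrite hp => -[] ?; congr EFin; lra.
Unshelve. all: by end_near. Qed.

End normal_tails.

(** * The truncated exponential tilt *)

Definition truncated_tilt {R : realType} (theta L x : R) : R :=
  expR (theta * x - theta ^+ 2 / 2) * \1_`]-oo, L] x.

Section truncated_tilt_moments.
Context {d : measure_display} {T : measurableType d} {R : realType}.
Variable P : probability T R.
Implicit Types (X : {RV P >-> R}) (theta L x : R).

Lemma gaussian_expR_indic X theta (A : set R) : standard_gaussian X -> measurable A ->
  (\int[P]_w (expR (theta * X w) * \1_A (X w))%:E =
   (expR (theta ^+ 2 / 2))%:E * normal_prob theta 1 A)%E.
Proof.
move=> gX mA; pose f x := expR (theta * x) * \1_A x.
have mf : measurable_fun setT f.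
  by apply: measurable_funM; [apply: measurableT_comp => //; exact: measurable_funM|exact: measurable_indic].
have f0 x : 0 <= f x by rewrite mulr_ge0 ?expR_ge0.
transitivity (\int[distribution P X]_x (f x)%:E)%E.
  by rewrite ge0_integral_distribution//; apply/measurable_EFinP.
rewrite (@ge0_integral_weighted_pushforward _ _ _ _ R (distribution P X) lebesgue_measure
  idfun (normal_pdf 0 1))//.
- rewrite normal_prob_indic// -ge0_integralZl//.
  + apply: eq_integral => x _; rewrite /f -EFinM; congr EFin.
    by rewrite /= mulrAC normal_pdf_tilt [X in _ = _ * X]mulrC mulrA.
  + apply/measurable_EFinP; apply: measurable_funM; first exact: measurable_indic.
    exact: measurable_normal_pdf.
  + by move=> x _; rewrite lee_fin mulr_ge0// normal_pdf_ge0.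
- by move=> mD Y mY; rewrite setTI.
- exact: measurable_normal_pdf.
- by move=> x; rewrite normal_pdf_ge0.
- by move=> B mB; rewrite -normal_prob_indic//; exact: gX.
Qed.

Lemma measurable_truncated_tilt theta L : measurable_fun setT (truncated_tilt theta L).
Proof.
apply: measurable_funM; last exact: measurable_indic.
by apply: measurableT_comp => //; apply: measurable_funB => //; exact: measurable_funM.
Qed.

Lemma truncated_tilt_ge0 theta L x : 0 <= truncated_tilt theta L x.
Proof. by rewrite mulr_ge0 ?expR_ge0. Qed.

Lemma truncated_tilt_le theta L x : 0 <= theta ->
  truncated_tilt theta L x <= expR (theta * L - theta ^+ 2 / 2).
Proof.
move=> t0; rewrite /truncated_tilt indicE.
case: (boolP (x \in _)) => [|_]; last by rewrite mulr0 expR_ge0.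
by rewrite inE/= in_itv/= => xL; rewrite mulr1 ler_expR lerD2r ler_wpM2l.
Qed.

(* One minus the mean of the truncated tilt, and [expR (- theta ^+ 2)] times its
   second moment. *)
Definition tilt_tail theta L : R := fine (normal_prob theta 1 `]L, +oo[%classic).
Definition tilt_head theta L : R := fine (normal_prob (2 * theta) 1 `]-oo, L]%classic).

Lemma truncated_tilt_mean X theta L : standard_gaussian X ->
  (\int[P]_w (truncated_tilt theta L (X w))%:E = (1 - tilt_tail theta L)%:E)%E.
Proof.
move=> gX.
transitivity ((expR (- (theta ^+ 2 / 2)))%:E *
    \int[P]_w (expR (theta * X w) * \1_`]-oo, L] (X w))%:E)%E.
  rewrite -ge0_integralZl//.
  - apply: eq_integral => w _; rewrite -EFinM; congr EFin.
    by rewrite /truncated_tilt expRD mulrCA mulrA.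
  - apply/measurable_EFinP; apply: measurable_funM.
      by apply: measurableT_comp => //; exact: measurable_funM.
    by apply: measurableT_comp => //; exact: measurable_indic.
rewrite gaussian_expR_indic// muleA -EFinM -expRD addNr expR0 mul1e.
have := probability_setC (normal_prob theta 1) (measurable_itv `]L, +oo[).
rewrite (_ : ~` _ = `]-oo, L]%classic); last first.
  by apply/seteqP; split=> x /=; rewrite !in_itv/= ?andbT leNgt => /negP.
by move=> ->; rewrite EFinB fineK// fin_num_measure.
Qed.

Lemma truncated_tilt_sqr_mean X theta L : standard_gaussian X ->
  (\int[P]_w (truncated_tilt theta L (X w) ^+ 2)%:E =
   (expR (theta ^+ 2) * tilt_head theta L)%:E)%E.
Proof.
move=> gX.
transitivity ((expR (- theta ^+ 2))%:E *
    \int[P]_w (expR (2 * theta * X w) * \1_`]-oo, L] (X w))%:E)%E.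
  rewrite -ge0_integralZl//.
  - apply: eq_integral => w _; rewrite -EFinM; congr EFin.
    rewrite /truncated_tilt exprMn [RHS]mulrA -expRD -expRM_natl; congr (expR _ * _).
      by field.
    by rewrite indicE; case: (_ \in _); rewrite ?expr1n ?expr0n.
  - apply/measurable_EFinP; apply: measurable_funM.
      by apply: measurableT_comp => //; exact: measurable_funM.
    by apply: measurableT_comp => //; exact: measurable_indic.
rewrite gaussian_expR_indic// muleA -EFinM -expRD.
rewrite -(@fineK _ (normal_prob _ _ _)) ?fin_num_measure// -EFinM.
by congr (expR _ * _)%:E; field.
Qed.

End truncated_tilt_moments.

Section truncated_mgf.
Context {d : measure_display} {T : measurableType d} {R : realType}.
Variable P : probability T R.
Variables (theta L : R).
Hypothesis theta0 : 0 <= theta.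
Local Notation U := (truncated_tilt theta L).
Local Notation p := (tilt_tail theta L).
Local Notation q := (tilt_head theta L).

Let bounded_integrable (f : T -> R) M : measurable_fun setT f ->
  (forall w, `|f w| <= M) -> P.-integrable setT (EFin \o f).
Proof.
move=> mf fM; apply: measurable_bounded_integrable => //.
  by rewrite (le_lt_trans (probability_le1 _ _))// ltry.
exists M; split; first exact: num_real.
by move=> x Mx w _; apply: le_trans (fM w) (ltW Mx).
Qed.

Let mUX (X : {RV P >-> R}) : measurable_fun setT (fun w => U (X w)).
Proof. by apply: measurableT_comp => //; exact: measurable_truncated_tilt. Qed.

Let integrable_U (X : {RV P >-> R}) : P.-integrable setT (fun w => (U (X w))%:E).
Proof.
apply: (bounded_integrable _ (expR (theta * L - theta ^+ 2 / 2))) => // w.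
by rewrite ger0_norm ?truncated_tilt_ge0// truncated_tilt_le.
Qed.

Let integrable_U2 (X : {RV P >-> R}) : P.-integrable setT (fun w => (U (X w) ^+ 2)%:E).
Proof.
apply: (bounded_integrable _ (expR (theta * L - theta ^+ 2 / 2) ^+ 2)) => [|w].
  exact: measurable_funX.
rewrite ger0_norm ?sqr_ge0// lerXn2r ?nnegrE ?truncated_tilt_ge0 ?expR_ge0//.
by rewrite truncated_tilt_le.
Qed.

Let integrable_quadratic (X : {RV P >-> R}) a0 a1 a2 :
  P.-integrable setT (fun w => (a0 + a1 * U (X w) + a2 * U (X w) ^+ 2)%:E).
Proof.
pose M := expR (theta * L - theta ^+ 2 / 2).
apply: (bounded_integrable _ (`|a0| + `|a1| * M + `|a2| * M ^+ 2)) => [|w].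
  apply: measurable_funD; last by apply: measurable_funM => //; exact: measurable_funX.
  by apply: measurable_funD => //; exact: measurable_funM.
have U0 := truncated_tilt_ge0 theta L (X w).
have UM : U (X w) <= M := truncated_tilt_le theta L (X w) theta0.
have U2 : U (X w) ^+ 2 <= M ^+ 2 by rewrite lerXn2r// nnegrE expR_ge0.
rewrite (le_trans (ler_normD _ _))// lerD//; last first.
  by rewrite normrM ler_wpM2l// ger0_norm// sqr_ge0.
rewrite (le_trans (ler_normD _ _))// lerD2l normrM ler_wpM2l//.
by rewrite ger0_norm.
Qed.

Let integral_quadratic (X : {RV P >-> R}) a0 a1 a2 : standard_gaussian X ->
  (\int[P]_w (a0 + a1 * U (X w) + a2 * U (X w) ^+ 2)%:E =
   (a0 + a1 * (1 - p) + a2 * (expR (theta ^+ 2) * q))%:E)%E.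
Proof.
move=> gX.
have i01 : P.-integrable setT (fun w => (a0 + a1 * U (X w))%:E).
  have := integrable_quadratic X a0 a1 0.
  by congr (P.-integrable _ _); apply/funext => w; rewrite mul0r addr0.
have i0 : P.-integrable setT (fun w => a0%:E : \bar R).
  have := integrable_quadratic X a0 0 0.
  by congr (P.-integrable _ _); apply/funext => w; rewrite !mul0r !addr0.
have i1 : P.-integrable setT (fun w => (a1 * U (X w))%:E).
  have := integrable_quadratic X 0 a1 0.
  by congr (P.-integrable _ _); apply/funext => w; rewrite mul0r add0r addr0.
have i2 : P.-integrable setT (fun w => (a2 * U (X w) ^+ 2)%:E).
  have := integrable_quadratic X 0 0 a2.
  by congr (P.-integrable _ _); apply/funext => w; rewrite mul0r !add0r.
under eq_integral do rewrite EFinD.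
rewrite (integralD measurableT i01 i2).
under eq_integral do rewrite EFinD.
rewrite (integralD measurableT i0 i1) integral_cst//.
rewrite [X in (_ * X + _ + _)%E](_ : _ = 1%E) ?mule1; last exact: probability_setT.
under eq_integral do rewrite EFinM.
rewrite (integralZl measurableT (integrable_U X)).
under [X in (_ + X)%E]eq_integral do rewrite EFinM.
rewrite (integralZl measurableT (integrable_U2 X)).
by rewrite truncated_tilt_mean// truncated_tilt_sqr_mean// -!EFinM -!EFinD.
Qed.

Definition tilt_variance : R := expR (theta ^+ 2) * q - 1 + 2 * p.

Lemma truncated_mgf_bounds (X : {RV P >-> R}) kappa eta : standard_gaussian X ->
  `|kappa| <= eta -> `|kappa| * expR (theta * L - theta ^+ 2 / 2) <= eta -> eta <= 1 ->
  ((1 + (- (kappa * p) + (1 / 2 - 8 * eta) * (kappa ^+ 2 * tilt_variance)))%:E <=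
     \int[P]_w (expR (kappa * (U (X w) - 1)))%:E /\
   \int[P]_w (expR (kappa * (U (X w) - 1)))%:E <=
     (1 + (- (kappa * p) + (1 / 2 + 8 * eta) * (kappa ^+ 2 * tilt_variance)))%:E)%E.
Proof.
move=> gX k1 kM eta1.
have vle w : `|kappa * (U (X w) - 1)| <= eta.
  rewrite normrM; have U0 := truncated_tilt_ge0 theta L (X w).
  have UM := truncated_tilt_le theta L (X w) theta0.
  have [U1|U1] := leP 1 (U (X w)).
    rewrite [X in _ * X]ger0_norm ?subr_ge0// (le_trans _ kM)// ler_wpM2l//; lra.
  rewrite [X in _ * X]ltr0_norm ?subr_lt0// (le_trans _ k1)// ler_piMr//; lra.
have iE : P.-integrable setT (fun w => (expR (kappa * (U (X w) - 1)))%:E).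
  apply: (bounded_integrable _ (expR eta)) => [|w].
    apply: measurableT_comp => //; apply: measurable_funM => //.
    exact: measurable_funB.
  rewrite ger0_norm ?expR_ge0// ler_expR; exact: le_trans (ler_norm _) (vle w).
have pt w : `|expR (kappa * (U (X w) - 1)) - (1 + kappa * (U (X w) - 1) + (kappa * (U (X w) - 1)) ^+ 2 / 2)|
   <= 8 * eta * (kappa * (U (X w) - 1)) ^+ 2.
  apply: le_trans (expR_taylor2 _ (le_trans (vle w) eta1)) _.
  by rewrite exprS real_normK ?num_real// -mulrA ler_pM2l// ler_wpM2r ?sqr_ge0.
have poly a : (\int[P]_w ((1 - kappa + a * kappa ^+ 2) + (kappa - 2 * a * kappa ^+ 2) * U (X w) +
    (a * kappa ^+ 2) * U (X w) ^+ 2)%:E = (1 + (- (kappa * p) + a * (kappa ^+ 2 * tilt_variance)))%:E)%E.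
  by rewrite integral_quadratic//; congr EFin; rewrite /tilt_variance; ring.
rewrite -!poly; split; apply: le_integral => //.
- move=> w _; rewrite lee_fin; move: (pt w); rewrite ler_norml => /andP[+ _]; lra.
- move=> w _; rewrite lee_fin; move: (pt w); rewrite ler_norml => /andP[_]; lra.
Qed.

End truncated_mgf.

(** * The truncated partition function *)

Section truncated_sum.
Context {d : measure_display} {T : measurableType d} {R : realType}.
Variable P : probability T R.
Variables (I : choiceType) (X : I -> {RV P >-> R}) (theta L : R).
Hypothesis theta0 : 0 <= theta.
Hypothesis indepX : mutually_independent X.
Hypothesis gX : forall i, standard_gaussian (X i).
Local Notation U := (truncated_tilt theta L).
Local Notation p := (tilt_tail theta L).
Local Notation S := (tilt_variance theta L).

Lemma truncated_sum_mgf_bounds (s : seq I) kappa eta : uniq s ->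
  `|kappa| <= eta -> `|kappa| * expR (theta * L - theta ^+ 2 / 2) <= eta -> eta <= 1 ->
  let wl := - (kappa * p) + (1 / 2 - 8 * eta) * (kappa ^+ 2 * S) in
  let wu := - (kappa * p) + (1 / 2 + 8 * eta) * (kappa ^+ 2 * S) in
  - 2^-1 <= wl ->
  ((expR ((size s)%:R * (wl - 2 * wl ^+ 2)))%:E <=
     \int[P]_w (expR (kappa * \sum_(i <- s) (U (X i w) - 1)))%:E /\
   \int[P]_w (expR (kappa * \sum_(i <- s) (U (X i w) - 1)))%:E <=
     (expR ((size s)%:R * wu))%:E)%E.
Proof.
move=> us k1 kM eta1 wl wu wl2.
pose f (i : I) x := expR (kappa * (U x - 1)).
have mf i : measurable_fun setT (f i).
  apply: measurableT_comp => //; apply: measurable_funM => //.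
  by apply: measurable_funB => //; exact: measurable_truncated_tilt.
have f0 i x : 0 <= f i x by exact: expR_ge0.
have b i := truncated_mgf_bounds P theta L theta0 (X i) kappa eta (gX i) k1 kM eta1.
have fin i : (\int[P]_w (f i (X i w))%:E < +oo)%E.
  by apply: le_lt_trans (b i).2 _; rewrite ltry.
pose m i := fine (\int[P]_w (f i (X i w))%:E)%E.
have mE i : (\int[P]_w (f i (X i w))%:E = (m i)%:E)%E.
  by rewrite fineK// ge0_fin_numE// integral_ge0// => w _; rewrite lee_fin.
have E : (\int[P]_w (expR (kappa * \sum_(i <- s) (U (X i w) - 1)))%:E =
    (\prod_(i <- s) m i)%:E)%E.
  rewrite -prodEFin -(eq_bigr _ (fun i _ => mE i)) -expectation_prod_independent//.
  by apply: eq_integral => w _; rewrite /f mulr_sumr expR_sum.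
have sizeE x : expR ((size s)%:R * x) = \prod_(i <- s) expR x.
  by rewrite -expR_sum; congr expR; rewrite big_const_seq count_predT iter_addr_0 mulr_natl.
rewrite E !sizeE !lee_fin; split; apply: ler_prod => i _.
- rewrite expR_ge0 /= -lee_fin -mE; apply: le_trans (b i).1.
  by rewrite lee_fin; exact: expR_subsqr_le1D.
- rewrite -!lee_fin -mE; apply/andP; split.
    by apply: integral_ge0 => w _; rewrite lee_fin.
  by apply: le_trans (b i).2 _; rewrite lee_fin expR_ge1Dx.
Qed.

End truncated_sum.

Lemma measure_bigsetU_le {d : measure_display} {T : measurableType d}
    {R : realType} (mu : {measure set T -> \bar R}) (I : Type) (s : seq I)
    (F : I -> set T) : (forall i, measurable (F i)) ->
  (mu (\big[setU/set0]_(i <- s) F i) <= \sum_(i <- s) mu (F i))%E.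
Proof.
move=> mF; elim: s => [|i s IH]; first by rewrite !big_nil measure0.
rewrite !big_cons; apply: (@le_trans _ _ (mu (F i) + mu (\big[setU/set0]_(j <- s) F j))%E).
  by apply: measureU2 => //; exact: bigsetU_measurable.
exact: leeD2l.
Qed.

Section rem_truncation.
Context {d : measure_display} {T : measurableType d} {R : realType}.
Variable P : probability T R.
Variable X : forall N, spins N -> {RV P >-> R}.
Variables (beta v : R) (t L : nat -> R).
Hypothesis remX : rem_disorder X.
Hypothesis beta0 : 0 < beta.
Hypothesis too : t @ \oo --> +oo.
Hypothesis v0 : 0 < v.

Definition rem_tilt N : R := beta * Num.sqrt N%:R.
Definition rem_scale N : R := expR (N%:R / 2 * (ln 2 - beta ^+ 2)).
Definition rem_card N : R := 2 ^+ N.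
Definition rem_cutoff N : R := expR (rem_tilt N * L N - rem_tilt N ^+ 2 / 2).
Definition rem_tail N : R := tilt_tail (rem_tilt N) (L N).
Definition rem_head N : R := tilt_head (rem_tilt N) (L N).

Local Notation theta := rem_tilt.
Local Notation a := rem_scale.
Local Notation n := rem_card.
Local Notation M := rem_cutoff.
Local Notation p := rem_tail.
Local Notation q := rem_head.

Hypothesis small_tilt : t N * (a N / n N) * (1 + M N) @[N --> \oo] --> (0 : R).
Hypothesis small_tail : a N * p N / t N @[N --> \oo] --> (0 : R).
Hypothesis head_cvg : q N @[N --> \oo] --> v.
Hypothesis small_t : t N ^+ 2 / n N @[N --> \oo] --> (0 : R).
Hypothesis rare : forall C, \forall N \near \oo,
  ((n N)%:E * normal_prob 0 1 `]L N, +oo[%classic <= (expR (- (t N ^+ 2 * C)))%:E)%E.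

Let theta_ge0 N : 0 <= theta N.
Proof. by rewrite mulr_ge0 ?sqrtr_ge0// ltW. Qed.

Let theta2 N : theta N ^+ 2 = beta ^+ 2 * N%:R.
Proof. by rewrite exprMn sqr_sqrtr. Qed.

Let n0 N : 0 < n N. Proof. by rewrite exprn_gt0. Qed.

Lemma rem_cardE N : n N = expR (N%:R * ln 2).
Proof. by rewrite expRM_natl lnK// posrE. Qed.

Let a2E N : a N ^+ 2 = n N * expR (- theta N ^+ 2).
Proof.
by rewrite rem_cardE -expRD -expRM_natl theta2; congr expR; field.
Qed.

Let cvg_exp_theta2 : expR (- theta N ^+ 2) @[N --> \oo] --> (0 : R).
Proof.
have h : theta N ^+ 2 @[N --> \oo] --> +oo.
  apply/cvgryPge => C; near=> N.
  rewrite theta2 mulrC -ler_pdivrMr ?exprn_gt0//.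
  by near: N; exact: nbhs_infty_ger.
exact: (cvg_comp _ _ h (@cvgr_expR R)).
Unshelve. all: by end_near. Qed.

Let G N w : R := a N / n N / t N *
  \sum_(s : spins N) (truncated_tilt (theta N) (L N) (X N s w) - 1).

Let A (sg lambda : R) N : R := - (lambda * (a N * p N / t N)) +
  (1 / 2 + sg * 8 * (`|lambda| * (t N * (a N / n N) * (1 + M N)))) *
  (lambda ^+ 2 * (q N - expR (- theta N ^+ 2) * (1 - 2 * p N))).

Let p01 N : 0 <= p N <= 1.
Proof.
rewrite /p /tilt_tail fine_ge0//= -lee_fin fineK ?fin_num_measure//.
exact: probability_le1.
Qed.

Let A_cvg sg lambda : A sg lambda N @[N --> \oo] --> lambda ^+ 2 * v / 2.
Proof.
have hN : - expR (- theta N ^+ 2) @[N --> \oo] --> - (0 : R) by apply: cvgN; exact: cvg_exp_theta2.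
rewrite oppr0 in hN.
have h : expR (- theta N ^+ 2) * (1 - 2 * p N) @[N --> \oo] --> (0 : R).
  apply: (@squeeze_cvgr _ _ _ _ (fun N => - expR (- theta N ^+ 2))
     (fun N => expR (- theta N ^+ 2))); [|exact: hN|exact: cvg_exp_theta2].
  apply: nearW => N; have /andP[p0 p1] := p01 N; have e0 := expR_ge0 (- theta N ^+ 2).
  by nra.
rewrite (_ : lambda ^+ 2 * v / 2 =
  - (lambda * 0) + (1 / 2 + sg * 8 * (`|lambda| * 0)) * (lambda ^+ 2 * (v - 0))); last by field.
rewrite /A; apply: cvgD; first by apply: cvgN; apply: cvgM => //; exact: cvg_cst.
apply: cvgM.
  apply: cvgD; first exact: cvg_cst.
  apply: cvgM; first exact: cvg_cst.
  by apply: cvgM => //; exact: cvg_cst.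
apply: cvgM; first exact: cvg_cst.
exact: cvgB.
Qed.

Lemma rem_mgf_bounds lambda e : 0 < e -> \forall N \near \oo,
  ((expR (t N ^+ 2 * (lambda ^+ 2 * v / 2 - e)))%:E <=
     \int[P]_w (expR (lambda * t N ^+ 2 * G N w))%:E /\
   \int[P]_w (expR (lambda * t N ^+ 2 * G N w))%:E <=
     (expR (t N ^+ 2 * (lambda ^+ 2 * v / 2 + e)))%:E)%E.
Proof.
move=> e0.
pose eta N := `|lambda| * (t N * (a N / n N) * (1 + M N)).
have eta_cvg : eta N @[N --> \oo] --> (0 : R).
  by rewrite -[X in _ --> X](mulr0 `|lambda|); apply: cvgM => //; exact: cvg_cst.
have Al := A_cvg (-1) lambda; have Au := A_cvg 1 lambda.
have Bl : A (-1) lambda N - 2 * (A (-1) lambda N * A (-1) lambda N * (t N ^+ 2 / n N)) @[N --> \oo]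
    --> lambda ^+ 2 * v / 2.
  rewrite -[X in _ --> X]subr0 -[X in _ - X](mulr0 2); apply: cvgB => //.
  apply: cvgM; first exact: cvg_cst.
  rewrite -[X in _ --> X](mulr0 (lambda ^+ 2 * v / 2 * (lambda ^+ 2 * v / 2))).
  by apply: cvgM => //; exact: cvgM.
have Wl : A (-1) lambda N * (t N ^+ 2 / n N) @[N --> \oo] --> (0 : R).
  by rewrite -[X in _ --> X](mulr0 (lambda ^+ 2 * v / 2)); exact: cvgM.
near=> N.
have tN : 0 < t N by near: N; have /cvgryPgt := too; exact.
have eta1 : eta N <= 1.
  by near: N; move/cvgrPdist_le : eta_cvg => /(_ 1 ltr01); apply: filterS => N;
    rewrite sub0r normrN; apply: le_trans; rewrite ler_norm.
have W2 : `|A (-1) lambda N * (t N ^+ 2 / n N)| <= 2^-1.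
  near: N; have h2 : (0 : R) < 2^-1 by rewrite invr_gt0.
  by move/cvgrPdist_le : Wl => /(_ _ h2); apply: filterS => N; rewrite sub0r normrN.
have B : lambda ^+ 2 * v / 2 - e <=
    A (-1) lambda N - 2 * (A (-1) lambda N * A (-1) lambda N * (t N ^+ 2 / n N)).
  near: N; move/cvgrPdist_le : Bl => /(_ _ e0); apply: filterS => N.
  by rewrite ler_norml => /andP[_]; rewrite lerBlDl -lerBlDr.
have C : A 1 lambda N <= lambda ^+ 2 * v / 2 + e.
  near: N; move/cvgrPdist_le : Au => /(_ _ e0); apply: filterS => N.
  by rewrite ler_norml => /andP[+ _]; lra.
pose kappa := lambda * t N * (a N / n N).
have c0 : 0 < a N / n N by rewrite divr_gt0 ?expR_gt0.
have kE : `|kappa| = `|lambda| * (t N * (a N / n N)).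
  by rewrite /kappa normrM (gtr0_norm c0) normrM (gtr0_norm tN) -mulrA.
have M0 : 0 < M N by exact: expR_gt0.
have tc0 : 0 < t N * (a N / n N) by rewrite mulr_gt0.
have k1 : `|kappa| <= eta N.
  by rewrite kE /eta ler_wpM2l// ler_pMr// lerDl ltW.
have kM : `|kappa| * expR (theta N * L N - theta N ^+ 2 / 2) <= eta N.
  by rewrite kE /eta -/(M N) -mulrA ler_wpM2l// ler_wpM2l ?(ltW tc0)// lerDr.
pose s := map (fun x : spins N => Tagged (fun N => spins N) x) (enum {: spins N}).
have us : uniq s.
  by rewrite map_inj_uniq ?enum_uniq// => x y /eqP; rewrite eq_Tagged => /eqP.
have sz : (size s)%:R = n N.
  by rewrite size_map -cardE card_ffun card_bool card_ord natrX.
have wE sg : n N * (- (kappa * p N) + (1 / 2 + sg * 8 * eta N) * (kappa ^+ 2 * tilt_variance (theta N) (L N))) =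
    t N ^+ 2 * A sg lambda N.
  have k2 : n N * kappa ^+ 2 = lambda ^+ 2 * t N ^+ 2 * expR (- theta N ^+ 2).
    rewrite /kappa exprMn [(lambda * _) ^+ 2]exprMn [(a N / _) ^+ 2]exprMn a2E exprVn; have := lt0r_neq0 (n0 N).
    by move: (n N) (expR _) => nn ee nn0; field.
  have k3 : n N * kappa = t N ^+ 2 * (lambda * (a N / t N)).
    rewrite /kappa; have := lt0r_neq0 (n0 N); have := lt0r_neq0 tN.
    by move: (n N) (a N) => nn aa t0 nn0; field; rewrite nn0 t0.
  have ee : expR (- theta N ^+ 2) * expR (theta N ^+ 2) = 1 by rewrite -expRD addNr expR0.
  have eS : expR (- theta N ^+ 2) * tilt_variance (theta N) (L N) =
      q N - expR (- theta N ^+ 2) * (1 - 2 * p N).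
    rewrite /tilt_variance -/(p N) -/(q N).
    move: (expR (- _)) (expR (theta N ^+ 2)) (p N) (q N) ee => e1 e2 pp qq ee.
    by transitivity (e1 * e2 * qq - e1 * (1 - 2 * pp)); [ring|rewrite ee mul1r].
  transitivity (- (n N * kappa * p N) +
      (1 / 2 + sg * 8 * eta N) * (n N * kappa ^+ 2 * tilt_variance (theta N) (L N))).
    by move: (n N) (p N) (tilt_variance _ _) (eta N) => nn pp SS hh; ring.
  rewrite k3 k2 -[_ * expR _ * tilt_variance _ _]mulrA eS /A -/(eta N).
  by move: (a N) (p N) (q N) (expR (- _)) (eta N) => aa pp qq e1 hh; ring.
have wlE := wE (-1); have wuE := wE 1.
have [gX indX] := remX.
have := truncated_sum_mgf_bounds P _ (fun i => X _ (tagged i)) (theta N) (L N) (theta_ge0 N) indX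
  (fun i => gX _ (tagged i)) s kappa (eta N) us k1 kM eta1.
have -> : 1 / 2 - 8 * eta N = 1 / 2 + - 1 * 8 * eta N by ring.
have -> : 1 / 2 + 8 * eta N = 1 / 2 + 1 * 8 * eta N by ring.
rewrite -/(p N) sz /=; set wl := - _ + (1 / 2 + -1 * _ * _) * _; set wu := - _ + (1 / 2 + 1 * _ * _) * _.
rewrite -/wl in wlE; rewrite -/wu in wuE.
have wlA : wl = A (-1) lambda N * (t N ^+ 2 / n N).
  by rewrite mulrA [A _ _ _ * _]mulrC -wlE mulrC mulKf// lt0r_neq0.
have -> : (\int[P]_w (expR (kappa * \sum_(i <- s) (truncated_tilt (theta N) (L N) (X _ (tagged i) w) - 1)))%:E =
    \int[P]_w (expR (lambda * t N ^+ 2 * G N w))%:E)%E.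
  apply: eq_integral => w _; congr (expR _)%:E.
  rewrite big_map big_enum /= /G /kappa [RHS]mulrA; congr (_ * _).
  have := lt0r_neq0 (n0 N); have := lt0r_neq0 tN.
  by move: (n N) (a N) => nn aa t0 nn0; field; rewrite nn0 t0.
move=> []; first by move: W2; rewrite -wlA ler_norml => /andP[].
move=> lo up; split.
- apply: le_trans lo; rewrite lee_fin ler_expR [leRHS]mulrBr wlE.
  rewrite (_ : n N * (2 * wl ^+ 2) = t N ^+ 2 * (2 * (A (-1) lambda N * A (-1) lambda N * (t N ^+ 2 / n N)))).
    by rewrite -mulrBr ler_wpM2l// sqr_ge0.
  by rewrite wlA; field; exact: lt0r_neq0.
- apply: le_trans up _; rewrite lee_fin ler_expR wuE.
  by rewrite ler_wpM2l// sqr_ge0.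
Unshelve. all: by end_near. Qed.

Hypothesis koo : a N / t N @[N --> \oo] --> +oo.

Let Zn N w : R := partition_fun X beta N w / fine ('E_P[partition_fun X beta N])%E.

Let ZnE N w : Zn N w = (n N)^-1 * \sum_(s : spins N) expR (theta N * X N s w - theta N ^+ 2 / 2).
Proof.
have [gX _] := remX.
have EZ : ('E_P[partition_fun X beta N] = (n N * expR (theta N ^+ 2 / 2))%:E)%E.
  rewrite unlock /partition_fun.
  under eq_integral do rewrite -sumEFin.
  rewrite ge0_integral_sum//; last first.
    move=> s; apply/measurable_EFinP; apply: measurableT_comp => //.
    exact: measurable_funM.
  rewrite (eq_bigr (fun=> (expR (theta N ^+ 2 / 2))%:E)).
    by rewrite sumEFin sumr_const card_ffun card_bool card_ord -[_ *+ (2 ^ N)]mulr_natl natrX.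
  move=> s _; have := gaussian_expR_indic P (X N s) (theta N) setT (gX N s) measurableT.
  rewrite [X in (_ * X)%E](_ : _ = 1%E) ?mule1; last exact: integral_normal_pdf.
  by move=> <-; apply: eq_integral => y _; rewrite indicT mulr1.
rewrite /Zn EZ /= invfM mulrCA; congr (_ * _).
rewrite /partition_fun mulr_suml; apply: eq_bigr => s _.
by rewrite expRD expRN.
Qed.

Let Zn_gt0 N w : 0 < Zn N w.
Proof.
rewrite ZnE mulr_gt0 ?invr_gt0//.
rewrite (bigD1 [ffun=> true])//= ltr_wpDr ?expR_gt0//.
by apply: sumr_ge0 => s _; exact: expR_ge0.
Qed.

Let H N w : R := a N / t N * (Zn N w - 1).

Let D N : set T := [set w | exists s, L N < X N s w].

Let GH N w : ~ D N w -> G N w = H N w.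
Proof.
move=> nD; rewrite /G /H ZnE.
rewrite (eq_bigr (fun s => expR (theta N * X N s w - theta N ^+ 2 / 2) - 1)); last first.
  move=> s _; rewrite /truncated_tilt indicE mem_set ?mulr1//= in_itv/= leNgt.
  by apply/negP => Ls; apply: nD; exists s.
rewrite big_split/= sumrN sumr_const card_ffun card_bool card_ord natrX -/(n N).
have := lt0r_neq0 (n0 N); set SS := \sum_s _.
by move: (n N) SS (t N)^-1 => nn SS tt nn0; field.
Qed.

Let mXL N s : measurable [set w | L N < X N s w].
Proof.
rewrite (_ : [set w | _] = X N s @^-1` `]L N, +oo[); last first.
  by apply/seteqP; split=> w /=; rewrite in_itv/= andbT.
by rewrite -[X in measurable X]setTI; exact: measurable_funP.
Qed.

Let DE N : D N = \big[setU/set0]_(s <- enum {: spins N}) [set w | L N < X N s w].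
Proof.
rewrite -bigcup_seq; apply/seteqP; split=> w [s].
  by move=> Ls; exists s => //=; rewrite mem_enum.
by move=> _ /= Ls; exists s.
Qed.

Let mD N : measurable (D N).
Proof. by rewrite DE; apply: bigsetU_measurable => s _; exact: mXL. Qed.

Let P_D N : (P (D N) <= (n N)%:E * normal_prob 0 1 `]L N, +oo[%classic)%E.
Proof.
have [gX _] := remX.
rewrite DE; apply: le_trans (measure_bigsetU_le P _ _ _ (mXL N)) _.
rewrite (eq_bigr (fun=> normal_prob 0 1 `]L N, +oo[%classic)); last first.
  move=> s _; rewrite -(gX N s)//; congr (P _).
  by apply/seteqP; split=> w /=; rewrite in_itv/= andbT.
rewrite -(@fineK _ (normal_prob 0 1 _)); last exact: (@fin_num_measure _ _ _ (normal_prob 0 1)).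
rewrite sumEFin big_const_seq count_predT iter_addr_0 -cardE card_ffun card_bool card_ord.
by rewrite -[_ *+ (2 ^ N)]mulr_natl natrX EFinM.
Qed.

Let D_small C : \forall N \near \oo, (P (D N) <= (expR (- (t N ^+ 2 * C)))%:E)%E.
Proof. by apply: filterS (rare C) => N; apply: le_trans; exact: P_D. Qed.

Let mG N : measurable_fun setT (G N).
Proof.
apply: measurable_funM => //; apply: measurable_sum => s.
apply: measurable_funB => //; apply: measurableT_comp => //.
exact: measurable_truncated_tilt.
Qed.

Let HkE N w : a N / t N != 0 -> 1 + H N w / (a N / t N) = Zn N w.
Proof. by move=> k0; rewrite /H mulrC mulKf// addrC subrK. Qed.

Let H1 N w : 0 < a N / t N -> 0 < 1 + H N w / (a N / t N).
Proof. by move=> k0; rewrite HkE ?lt0r_neq0. Qed.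

Let WH N w : scaled_log_partition X t beta N w = a N / t N * ln (1 + H N w / (a N / t N)).
Proof.
have [k0|k0] := eqVneq (a N / t N) 0; last by rewrite HkE.
by rewrite k0 mul0r /scaled_log_partition -/(a N) k0 mul0r.
Qed.

Let t2oo : (fun N => t N ^+ 2) @ \oo --> +oo.
Proof.
apply/cvgryPge => C; near=> N.
have t1 : Num.max 1 C <= t N by near: N; have /cvgryPge := too; exact.
move: t1; rewrite ge_max => /andP[t1 tC].
by rewrite (le_trans tC)// expr2 ler_peMr// (le_trans ler01 t1).
Unshelve. all: by end_near. Qed.

Lemma rem_upper rho r : 0 < rho -> r < rho ^+ 2 / (2 * v) ->
  \forall N \near \oo,
    (P [set w | rho <= `|scaled_log_partition X t beta N w|]%R <= (expR (- (t N ^+ 2 * r)))%:E)%E.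
Proof.
exact: (log_transfer_upper P G H _ D _ (fun N => a N / t N) v mG
  (measurable_scaled_log_partition X t beta) mD t2oo koo v0 GH H1 WH D_small rem_mgf_bounds).
Qed.

Lemma rem_lower x delta r : 0 < delta -> x ^+ 2 / (2 * v) < r ->
  \forall N \near \oo,
    ((expR (- (t N ^+ 2 * r)))%:E <=
     P [set w | `|scaled_log_partition X t beta N w - x| < delta]%R)%E.
Proof.
exact: (log_transfer_lower P G H _ D _ (fun N => a N / t N) v mG
  (measurable_scaled_log_partition X t beta) mD t2oo koo v0 GH H1 WH D_small rem_mgf_bounds).
Qed.

End rem_truncation.

(** * The two temperature regimes *)

Section asymptotics.
Context {R : realType}.

Lemma cvg0_norm_le (f g : nat -> R) : (\forall N \near \oo, `|f N| <= g N) ->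
  g N @[N --> \oo] --> (0 : R) -> f N @[N --> \oo] --> (0 : R).
Proof.
move=> fg g0; apply/cvgrPdist_le => e e0.
near=> N; rewrite sub0r normrN; apply: (@le_trans _ _ (g N)); first by near: N.
apply: le_trans (ler_norm _) _; near: N; exact: (cvgr0_norm_le g g0 e e0).
Unshelve. all: by end_near. Qed.

Lemma cvg_mul_expRN (f : nat -> R) (kappa : R) : 0 < kappa ->
  f N @[N --> \oo] --> +oo ->
  f N * expR (- (kappa * f N)) @[N --> \oo] --> (0 : R).
Proof.
move=> k0 foo; apply/cvgrPdist_le => e e0; near=> N.
have f0 : 0 < f N by near: N; have /cvgryPgt := foo; exact.
have fe : 2 / (kappa ^+ 2 * e) <= f N by near: N; have /cvgryPge := foo; exact.
rewrite sub0r normrN ger0_norm ?mulr_ge0 ?expR_ge0 ?(ltW f0)// expRN ler_pdivrMr ?expR_gt0//.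
have kf : 0 <= kappa * f N by rewrite mulr_ge0 ?ltW.
have := expR_ge1Dxn 1 kf; rewrite (_ : 2`!%:R = 2 :> R)// => h.
have : 2 <= f N * (kappa ^+ 2 * e) by rewrite -ler_pdivrMr// mulr_gt0 ?exprn_gt0.
move=> h2; apply: (@le_trans _ _ (e * ((kappa * f N) ^+ 2 / 2))); last first.
  by rewrite ler_wpM2l ?(ltW e0)// (le_trans _ h)// lerDr.
rewrite [leRHS](_ : _ = f N * (f N * (kappa ^+ 2 * e)) / 2); last by field.
by rewrite ler_pdivlMr// ler_wpM2l// ltW.
Unshelve. all: by end_near. Qed.

Lemma cvg_natr_infty : (N%:R : R) @[N --> \oo] --> +oo.
Proof. by apply/cvgryPge => C; exact: nbhs_infty_ger. Qed.

Lemma cvg_ln_natr_infty : (ln N%:R : R) @[N --> \oo] --> +oo.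
Proof.
apply/cvgryPge => C; near=> N.
have h : expR C <= N%:R by near: N; exact: nbhs_infty_ger.
by rewrite -(expRK C) ler_ln ?posrE ?expR_gt0// (lt_le_trans (expR_gt0 C)).
Unshelve. all: by end_near. Qed.

Lemma cvg_natr_expRN (kappa : R) : 0 < kappa ->
  N%:R * expR (- (kappa * N%:R)) @[N --> \oo] --> (0 : R).
Proof. by move=> k0; exact: (cvg_mul_expRN _ _ k0 cvg_natr_infty). Qed.

Lemma cvg_ln_expRN (kappa : R) : 0 < kappa ->
  ln N%:R * expR (- (kappa * ln N%:R)) @[N --> \oo] --> (0 : R).
Proof. by move=> k0; exact: (cvg_mul_expRN _ _ k0 cvg_ln_natr_infty). Qed.

Lemma sqrt_natr_expR (N : nat) : (0 < N)%N -> Num.sqrt N%:R = expR (ln N%:R / 2) :> R.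
Proof.
move=> N0; have N0' : 0 < N%:R :> R by rewrite ltr0n.
apply/eqP; rewrite -(@eqrXn2 _ 2)// ?sqrtr_ge0 ?expR_ge0//.
by rewrite sqr_sqrtr ?(ltW N0')// -expRM_natl mulrC divfK// lnK// posrE.
Qed.

Lemma sqrt_natr_ge1 (N : nat) : (0 < N)%N -> 1 <= Num.sqrt N%:R :> R.
Proof. by move=> N0; rewrite -[leLHS]sqrtr1 ler_wsqrtr// ler1n. Qed.

Lemma sqrt_natr_le (N : nat) : Num.sqrt N%:R <= N%:R :> R.
Proof.
have [->|] := posnP N; first by rewrite sqrtr0.
move=> /sqrt_natr_ge1 s1; rewrite -[leRHS]sqr_sqrtr// expr2 ler_peMr//.
Qed.

Lemma ln2_gt0 : 0 < ln 2 :> R.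
Proof. by rewrite ln_gt0// ltr1n. Qed.

End asymptotics.

Section moderate_scaling.
Context {R : realType}.
Variables (beta : R) (t : nat -> R).
Hypothesis beta0 : 0 < beta.
Hypothesis too : t @ \oo --> +oo.
Hypothesis tle : \forall N \near \oo, t N <= Num.sqrt N%:R.

Let t_pos : \forall N \near \oo, 1 <= t N.
Proof. by have /cvgryPge := too; exact. Qed.

Lemma small_t2_card : t N ^+ 2 / rem_card N @[N --> \oo] --> (0 : R).
Proof.
apply: cvg0_norm_le (cvg_natr_expRN _ ln2_gt0); near=> N.
have t1 : 1 <= t N by near: N.
have ts : t N <= Num.sqrt N%:R by near: N.
have n0 : 0 < rem_card N :> R by rewrite exprn_gt0.
rewrite ger0_norm ?divr_ge0 ?sqr_ge0 ?(ltW n0)// rem_cardE mulrC [ln 2 * _]mulrC expRN.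
rewrite [leRHS]mulrC ler_wpM2l ?invr_ge0 ?expR_ge0//.
by rewrite -[leRHS]sqr_sqrtr// lerXn2r ?nnegrE ?sqrtr_ge0// (le_trans ler01).
Unshelve. all: by end_near. Qed.

Lemma scale_t_infty : beta ^+ 2 < ln 2 -> rem_scale beta N / t N @[N --> \oo] --> +oo.
Proof.
move=> b2; pose c := (ln 2 - beta ^+ 2) / 2.
have c0 : 0 < c by rewrite divr_gt0// subr_gt0.
apply/cvgryPge => C; pose C' := Num.max 1 C.
have C'0 : 0 < C' by rewrite lt_max ltr01.
near=> N.
have t1 : 1 <= t N by near: N.
have ts : t N <= Num.sqrt N%:R by near: N.
have t0 : 0 < t N by rewrite (lt_le_trans ltr01).
have small : `|N%:R * expR (- (c * N%:R))| <= C'^-1.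
  near: N; apply: (cvgr0_norm_le _ (cvg_natr_expRN _ c0)).
  by rewrite invr_gt0.
have N0 : 0 < N%:R :> R by rewrite (lt_le_trans t0)// (le_trans ts)// sqrt_natr_le.
move: small; rewrite ger0_norm ?mulr_ge0 ?expR_ge0// expRN => small.
rewrite ler_pdivlMr// (le_trans (ler_wpM2r (ltW t0) (_ : C <= C')))//; first by rewrite le_max lexx orbT.
rewrite (le_trans (ler_wpM2l (ltW C'0) (le_trans ts (sqrt_natr_le N))))//.
rewrite /rem_scale (_ : N%:R / 2 * _ = c * N%:R); last by rewrite /c; field.
by move: small; rewrite ler_pdivrMr ?expR_gt0// -ler_pdivlMl ?invr_gt0// invrK.
Unshelve. all: by end_near. Qed.

Let scale_cardE N : rem_scale beta N / rem_card N = expR (- ((ln 2 + beta ^+ 2) / 2 * N%:R)).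
Proof. by rewrite rem_cardE /rem_scale -expRB; congr expR; field. Qed.

Lemma small_t_scale_card : t N * (rem_scale beta N / rem_card N) @[N --> \oo] --> (0 : R).
Proof.
have k0 : 0 < (ln 2 + beta ^+ 2) / 2 by rewrite divr_gt0// addr_gt0 ?ln2_gt0 ?exprn_gt0.
apply: cvg0_norm_le (cvg_natr_expRN _ k0); near=> N.
have t1 : 1 <= t N by near: N.
have ts : t N <= Num.sqrt N%:R by near: N.
have t0 : 0 <= t N by rewrite (le_trans ler01).
rewrite scale_cardE ger0_norm ?mulr_ge0 ?expR_ge0//.
by rewrite ler_wpM2r ?expR_ge0// (le_trans ts)// sqrt_natr_le.
Unshelve. all: by end_near. Qed.

Lemma small_tilt_of_cutoff (L : nat -> R) :
  t N * (rem_scale beta N / rem_card N) * rem_cutoff beta L N @[N --> \oo] --> (0 : R) ->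
  t N * (rem_scale beta N / rem_card N) * (1 + rem_cutoff beta L N) @[N --> \oo] --> (0 : R).
Proof.
move=> h.
have {}h : t N * (rem_scale beta N / rem_card N) +
    t N * (rem_scale beta N / rem_card N) * rem_cutoff beta L N @[N --> \oo] --> (0 + 0 : R).
  by apply: cvgD => //; exact: small_t_scale_card.
rewrite addr0 in h; apply: cvg_trans h; apply: near_eq_cvg; apply: nearW => N.
by rewrite mulrDr mulr1.
Qed.

End moderate_scaling.

Section tilt_bounds.
Context {R : realType}.
Implicit Types theta L : R.

Lemma normal_prob_fineK m (A : set R) : measurable A ->
  (fine (normal_prob m 1 A))%:E = normal_prob m 1 A.
Proof. by move=> mA; rewrite fineK// (@fin_num_measure _ _ _ (normal_prob m 1)). Qed.

Lemma tilt_tail_ge0 theta L : 0 <= tilt_tail theta L.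
Proof. by rewrite fine_ge0. Qed.

Lemma tilt_tail_le theta L : theta < L ->
  tilt_tail theta L <= expR (- ((L - theta) ^+ 2 / 2)) / (L - theta).
Proof.
by move=> tL; rewrite -lee_fin normal_prob_fineK//; exact: normal_prob_tail_le.
Qed.

Lemma tilt_headE theta L : tilt_head theta L = 1 - tilt_tail (2 * theta) L.
Proof.
apply: EFin_inj; rewrite EFinB !normal_prob_fineK//.
rewrite -(probability_setC (normal_prob (2 * theta) 1) (measurable_itv `]L, +oo[)).
congr (normal_prob _ _ _).
by apply/seteqP; split=> x /=; rewrite !in_itv/= ?andbT leNgt => /negP.
Qed.

Lemma tilt_head_half theta L : L <= 2 * theta ->
  `|2^-1 - tilt_head theta L| <= 2 * theta - L.
Proof.
move=> Lt; pose r := fine (normal_prob (2 * theta) 1 `]L, 2 * theta]%classic).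
have r0 : 0 <= r by rewrite fine_ge0.
have rL : r <= 2 * theta - L.
  by rewrite -lee_fin normal_prob_fineK//; exact: normal_prob_itvoc_le.
suff E : 2^-1 = tilt_head theta L + r by rewrite E addrC addKr ger0_norm.
apply: EFin_inj; rewrite EFinD !normal_prob_fineK// -(normal_prob_half (2 * theta)).
rewrite -(measureU (normal_prob (2 * theta) 1))//.
  congr (normal_prob _ _ _); apply/seteqP; split=> x /=; rewrite !in_itv/=.
    by move=> xt; have [xL|xL] := leP x L; [left|right].
  by move=> [xL|/andP[]//]; exact: le_trans Lt.
by rewrite -subset0 => x [] /=; rewrite !in_itv/= => xL /andP[]; rewrite ltNge xL.
Qed.

End tilt_bounds.

Definition moderate_deviations {d : measure_display} {T : measurableType d} {R : realType}
    (P : probability T R) (W : nat -> T -> R) (gamma : nat -> R) (v : R) :=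
  (forall rho r, 0 < rho -> r < rho ^+ 2 / (2 * v) ->
    \forall N \near \oo,
      (P [set w | rho <= `|W N w|]%R <= (expR (- (gamma N * r)))%:E)%E) /\
  (forall x delta r, 0 < delta -> x ^+ 2 / (2 * v) < r ->
    \forall N \near \oo,
      ((expR (- (gamma N * r)))%:E <= P [set w | `|W N w - x| < delta]%R)%E).

Section subcritical.
Context {d : measure_display} {T : measurableType d} {R : realType}.
Variable P : probability T R.
Variable X : forall N, spins N -> {RV P >-> R}.
Variables (beta : R) (t : nat -> R).
Hypothesis remX : rem_disorder X.
Hypothesis beta0 : 0 < beta.
Hypothesis too : t @ \oo --> +oo.
Hypothesis bsub : beta < Num.sqrt (ln 2 / 2).
Hypothesis tsmall : forall e, 0 < e -> \forall N \near \oo, `|t N| <= e * Num.sqrt N%:R.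

Let l2 : 0 < ln 2 :> R := ln2_gt0.

Let b2 : beta ^+ 2 < ln 2 / 2.
Proof.
rewrite -[ltRHS]sqr_sqrtr ?divr_ge0 ?(ltW l2)//.
by rewrite ltrXn2r ?nnegrE ?sqrtr_ge0 ?(ltW beta0).
Qed.

(* With [h = sqrt (2 ln 2)], the admissible slopes lie between [h] and
   [h^2 / (4 beta) + beta]; the gap is [(h / 2 - beta)^2 / beta > 0]. *)
Let slope_exists : exists l : R, [/\ 2 * beta < l, 2 * ln 2 < l ^+ 2,
  beta * l < ln 2 / 2 + beta ^+ 2 & ln 2 - beta ^+ 2 < (l - beta) ^+ 2].
Proof.
pose h : R := Num.sqrt (2 * ln 2); pose u := ln 2 / (2 * beta) + beta.
have h2 : h ^+ 2 = 2 * ln 2 by rewrite sqr_sqrtr// mulr_ge0// ltW.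
have h0 : 0 <= h by exact: sqrtr_ge0.
have hb : 2 * beta < h.
  by rewrite -(@ltr_pXn2r _ 2)// ?nnegrE ?mulr_ge0 ?(ltW beta0)// h2 exprMn; have := b2; lra.
have bu : beta * u = ln 2 / 2 + beta ^+ 2 by rewrite /u; field; exact: lt0r_neq0.
have hu : h < u.
  rewrite -(ltr_pM2l beta0) bu; have : 0 < (h - 2 * beta) ^+ 2 by rewrite exprn_gt0// subr_gt0.
  by rewrite sqrrB h2; nra.
exists ((h + u) / 2); have hl : h < (h + u) / 2 by rewrite midf_lt.
have lu : (h + u) / 2 < u by rewrite midf_lt.
split.
- exact: lt_trans hl.
- by rewrite -h2 ltrXn2r ?nnegrE// (le_trans h0)// ltW.
- by rewrite -bu ltr_pM2l.
- apply: (@lt_trans _ _ ((h - beta) ^+ 2)); last first.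
    by rewrite ltrXn2r ?nnegrE ?subr_ge0//; lra.
  have : 0 < (h - 2 * beta) ^+ 2 by rewrite exprn_gt0// subr_gt0.
  by rewrite !sqrrB h2; nra.
Qed.

Lemma rem_subcritical_mdp :
  moderate_deviations P (scaled_log_partition X t beta) (fun N => t N ^+ 2) 1.
Proof.
have [l [lb lh bl lab]] := slope_exists.
pose L N : R := l * Num.sqrt N%:R.
have lb0 : 0 < l - beta by rewrite subr_gt0 (lt_trans _ lb)// ltr_pMl// ltr1n.
have l0 : 0 < l by rewrite (lt_trans _ lb)// mulr_gt0.
have tle : \forall N \near \oo, t N <= Num.sqrt N%:R.
  by apply: filterS (tsmall 1 ltr01) => N; rewrite mul1r; apply: le_trans; exact: ler_norm.
have t1 : \forall N \near \oo, 1 <= t N by have /cvgryPge := too; exact.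
have s2 N : Num.sqrt N%:R * Num.sqrt N%:R = N%:R :> R by rewrite -expr2 sqr_sqrtr.
have decay kappa c : 0 < kappa -> c * (N%:R * expR (- (kappa * N%:R))) @[N --> \oo] --> (0 : R).
  move=> k0; rewrite -[X in _ --> X](mulr0 c); apply: cvgM; first exact: cvg_cst.
  exact: cvg_natr_expRN.
have tail_decay m c : m < l -> \forall N \near \oo,
    expR (c * N%:R) * tilt_tail (m * Num.sqrt N%:R) (L N) <=
    (l - m)^-1 * expR (- (((l - m) ^+ 2 / 2 - c) * N%:R)).
  move=> ml; near=> N.
  have N0 : (0 < N)%N by near: N; exact: nbhs_infty_gt.
  have s1 : 1 <= Num.sqrt N%:R :> R by exact: sqrt_natr_ge1.
  have s0 : 0 < Num.sqrt N%:R :> R by exact: lt_le_trans s1.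
  have lm : 0 < l - m by rewrite subr_gt0.
  have mL : m * Num.sqrt N%:R < L N by rewrite ltr_pM2r.
  have -> : expR (- (((l - m) ^+ 2 / 2 - c) * N%:R)) = expR (c * N%:R) * expR (- ((L N - m * Num.sqrt N%:R) ^+ 2 / 2)).
    rewrite -expRD; congr expR; rewrite /L -mulrBl exprMn sqr_sqrtr//; by field.
  rewrite mulrCA ler_wpM2l ?expR_ge0// (le_trans (tilt_tail_le _ _ mL))//.
  rewrite mulrC ler_wpM2r ?expR_ge0// lef_pV2 ?posrE ?subr_gt0//.
  by rewrite /L -mulrBl ler_peMr// ltW.
have le_mulN N (x : R) : (0 < N)%N -> 0 <= x -> x <= N%:R * x.
  by move=> N0 x0; rewrite ler_peMl// ler1n.
have b2l : beta ^+ 2 < ln 2 by have := b2; have := l2; lra.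
have small_tilt : t N * (rem_scale beta N / rem_card N) * (1 + rem_cutoff beta L N)
    @[N --> \oo] --> (0 : R).
  apply: small_tilt_of_cutoff => //.
  pose k1 : R := ln 2 / 2 + beta ^+ 2 - beta * l.
  have k10 : 0 < k1 by rewrite subr_gt0.
  apply: cvg0_norm_le (cvg_natr_expRN _ k10); near=> N.
  have t1N : 1 <= t N by near: N.
  have tN : t N <= Num.sqrt N%:R by near: N.
  have t0 : 0 <= t N by exact: le_trans t1N.
  rewrite -mulrA ger0_norm; last by rewrite !mulr_ge0 ?expR_ge0 ?invr_ge0// exprn_ge0.
  rewrite (_ : rem_scale beta N / rem_card N * rem_cutoff beta L N = expR (- (k1 * N%:R))).
    by rewrite ler_wpM2r ?expR_ge0// (le_trans tN)// sqrt_natr_le.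
  rewrite rem_cardE /rem_scale /rem_cutoff -expRB -expRD; congr expR.
  rewrite /rem_tilt /L /k1 exprMn mulrACA s2 sqr_sqrtr//; by field.
have small_tail : rem_scale beta N * rem_tail beta L N / t N @[N --> \oo] --> (0 : R).
  pose c : R := (ln 2 - beta ^+ 2) / 2.
  have k20 : 0 < (l - beta) ^+ 2 / 2 - c by rewrite /c -mulrBl divr_gt0// subr_gt0.
  apply: cvg0_norm_le (decay _ (l - beta)^-1 k20); near=> N.
  have t1N : 1 <= t N by near: N.
  have N0 : (0 < N)%N by near: N; exact: nbhs_infty_gt.
  have t0 : 0 < t N by exact: lt_le_trans t1N.
  have td : expR (c * N%:R) * tilt_tail (beta * Num.sqrt N%:R) (L N) <=
      (l - beta)^-1 * expR (- (((l - beta) ^+ 2 / 2 - c) * N%:R)).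
    by near: N; apply: tail_decay; rewrite -subr_gt0.
  have e0 : 0 <= rem_scale beta N * rem_tail beta L N by rewrite mulr_ge0 ?expR_ge0 ?tilt_tail_ge0.
  rewrite ger0_norm ?divr_ge0 ?(ltW t0)//.
  apply: (@le_trans _ _ (rem_scale beta N * rem_tail beta L N)).
    by rewrite ler_pdivrMr// ler_peMr.
  rewrite /rem_scale (_ : N%:R / 2 * _ = c * N%:R); last by rewrite /c; field.
  by apply: le_trans td _; rewrite ler_wpM2l ?invr_ge0 ?(ltW lb0)// le_mulN// expR_ge0.
have head_cvg : rem_head beta L N @[N --> \oo] --> (1 : R).
  have lm0 : 0 < l - 2 * beta by rewrite subr_gt0.
  have k0 : 0 < (l - 2 * beta) ^+ 2 / 2 - 0 by rewrite subr0 divr_gt0// exprn_gt0.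
  have h : tilt_tail (2 * rem_tilt beta N) (L N) @[N --> \oo] --> (0 : R).
    apply: cvg0_norm_le (decay _ (l - 2 * beta)^-1 k0); near=> N.
    have N0 : (0 < N)%N by near: N; exact: nbhs_infty_gt.
    have td : expR (0 * N%:R) * tilt_tail (2 * beta * Num.sqrt N%:R) (L N) <=
        (l - 2 * beta)^-1 * expR (- (((l - 2 * beta) ^+ 2 / 2 - 0) * N%:R)).
      by near: N; exact: tail_decay.
    rewrite ger0_norm ?tilt_tail_ge0// /rem_tilt mulrA.
    move: td; rewrite mul0r expR0 mul1r => /le_trans; apply.
    by rewrite ler_wpM2l ?invr_ge0 ?(ltW lm0)// le_mulN// expR_ge0.
  have {}h : 1 - tilt_tail (2 * rem_tilt beta N) (L N) @[N --> \oo] --> (1 - 0 : R).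
    by apply: cvgB => //; exact: cvg_cst.
  rewrite subr0 in h; apply: cvg_trans h; apply: near_eq_cvg; apply: nearW => N.
  by rewrite /rem_head tilt_headE.
have rare C : \forall N \near \oo,
    ((rem_card N)%:E * normal_prob 0 1 `]L N, +oo[%classic <= (expR (- (t N ^+ 2 * C)))%:E)%E.
  pose k3 : R := l ^+ 2 / 2 - ln 2.
  have k30 : 0 < k3 by rewrite subr_gt0 ltr_pdivlMr// mulrC.
  pose e : R := Num.sqrt (k3 / 2 / (`|C| + 1)).
  have C0 : 0 < `|C| + 1 by rewrite ltr_wpDl.
  have e0 : 0 < e by rewrite sqrtr_gt0 !divr_gt0.
  near=> N.
  have td : expR (ln 2 * N%:R) * tilt_tail (0 * Num.sqrt N%:R) (L N) <=
      (l - 0)^-1 * expR (- (((l - 0) ^+ 2 / 2 - ln 2) * N%:R)).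
    by near: N; exact: tail_decay.
  have te : `|t N| <= e * Num.sqrt N%:R by near: N; exact: tsmall.
  have ex : l^-1 * expR (- (N%:R * k3)) <= expR (- (N%:R * (k3 / 2))).
    near: N; apply: le_exp_bounds_near; first exact: cvg_natr_infty.
    by rewrite ltr_pdivrMr// ltr_pMr// ltr1n.
  have {}td : expR (N%:R * ln 2) * fine (normal_prob 0 1 `]L N, +oo[%classic) <=
      l^-1 * expR (- (N%:R * k3)).
    by move: td; rewrite mul0r !subr0 -/k3 [ln 2 * _]mulrC [k3 * _]mulrC.
  rewrite -(normal_prob_fineK 0)// -EFinM lee_fin rem_cardE; apply: le_trans td _.
  apply: le_trans ex _; rewrite ler_expR lerN2.
  have t2 : t N ^+ 2 <= k3 / 2 / (`|C| + 1) * N%:R.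
    have eE : e ^+ 2 = k3 / 2 / (`|C| + 1).
      by rewrite sqr_sqrtr// ltW// !divr_gt0.
    have sE : N%:R = Num.sqrt N%:R ^+ 2 :> R by rewrite sqr_sqrtr.
    rewrite -eE sE -exprMn -(real_normK (num_real (t N))).
    by rewrite lerXn2r ?nnegrE ?mulr_ge0 ?(ltW e0) ?sqrtr_ge0.
  apply: (@le_trans _ _ (t N ^+ 2 * (`|C| + 1))).
    by rewrite ler_wpM2l ?sqr_ge0// (le_trans (ler_norm _))// lerDl.
  by apply: le_trans (ler_wpM2r (ltW C0) t2) _; rewrite mulrAC divfK ?lt0r_neq0// mulrC.
have koo := scale_t_infty _ _ too tle b2l.
have st := small_t2_card _ too tle.
split=> [rho r|x delta r].
- exact: (rem_upper P X beta 1 t L remX beta0 too ltr01 small_tilt small_tail head_cvg st rare koo).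
- exact: (rem_lower P X beta 1 t L remX beta0 too ltr01 small_tilt small_tail head_cvg st rare koo).
Unshelve. all: by end_near. Qed.

End subcritical.

Section critical.
Context {d : measure_display} {T : measurableType d} {R : realType}.
Variable P : probability T R.
Variable X : forall N, spins N -> {RV P >-> R}.
Variables (beta : R) (t : nat -> R).
Hypothesis remX : rem_disorder X.
Hypothesis beta0 : 0 < beta.
Hypothesis too : t @ \oo --> +oo.
Hypothesis bcrit : beta ^+ 2 = ln 2 / 2.
Hypothesis tsmall : forall e, 0 < e -> \forall N \near \oo, `|t N| <= e * Num.sqrt (ln N%:R).

Let ln2E : ln 2 = 2 * beta ^+ 2.
Proof. by rewrite bcrit; field. Qed.

Lemma rem_critical_mdp :
  moderate_deviations P (scaled_log_partition X t beta) (fun N => t N ^+ 2) 2^-1.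
Proof.
(* The shift [rho] lowers the level [2 beta sqrt N], the order of the maximum of
   the Gaussians, by [ln N / (8 beta sqrt N)]: enough for the summands to be
   [N^(-1/8)]-small, and little enough for the union bound to remain
   [N^(-1/4)]-small thanks to the factor [1 / sqrt N] in the normal tail. *)
pose rho N : R := ln N%:R / (8 * beta * Num.sqrt N%:R).
pose L N : R := 2 * rem_tilt beta N - rho N.
have decay kappa c : 0 < kappa -> c * (ln N%:R * expR (- (kappa * ln N%:R))) @[N --> \oo] --> (0 : R).
  move=> k0; rewrite -[X in _ --> X](mulr0 c); apply: cvgM; first exact: cvg_cst.
  exact: cvg_ln_expRN.
have ln1 : \forall N \near \oo, 1 <= ln N%:R :> R.
  by have /cvgryPge := @cvg_ln_natr_infty R; exact.
have t1 : \forall N \near \oo, 1 <= t N by have /cvgryPge := too; exact.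
have le_mulln N (x : R) : 1 <= ln N%:R :> R -> 0 <= x -> x <= ln N%:R * x.
  by move=> N0 x0; rewrite ler_peMl.
have tln : \forall N \near \oo, t N <= ln N%:R.
  near=> N; have l1 : 1 <= ln N%:R :> R by near: N.
  have : `|t N| <= 1 * Num.sqrt (ln N%:R) by near: N; exact: tsmall.
  rewrite mul1r => /(le_trans (ler_norm _))/le_trans; apply.
  have s1 : 1 <= Num.sqrt (ln N%:R) :> R by rewrite -[leLHS]sqrtr1 ler_wsqrtr.
  rewrite -[leRHS]sqr_sqrtr ?(le_trans ler01 l1)// expr2 ler_peMr// (le_trans _ s1)//.
have tle : \forall N \near \oo, t N <= Num.sqrt N%:R.
  near=> N; have N0 : (0 < N)%N by near: N; exact: nbhs_infty_gt.
  have : `|t N| <= 1 * Num.sqrt (ln N%:R) by near: N; exact: tsmall.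
  rewrite mul1r => /(le_trans (ler_norm _))/le_trans; apply.
  by rewrite ler_wsqrtr// ltW// ln_sublinear// ltr0n.
have rhoE N : (0 < N)%N -> rho N = (8 * beta)^-1 * (ln N%:R * expR (- (2^-1 * ln N%:R))).
  move=> N0; rewrite /rho invfM mulrCA; congr (_ * (_ * _)).
  by rewrite sqrt_natr_expR// expRN; congr (expR _)^-1; rewrite mulrC.
have rho_cvg : rho N @[N --> \oo] --> (0 : R).
  apply: cvg_trans (decay 2^-1 (8 * beta)^-1 _) => //.
  apply: near_eq_cvg; near=> N; rewrite rhoE//.
  by near: N; exact: nbhs_infty_gt.
have facts : \forall N \near \oo, [/\ (0 < N)%N, 1 <= ln N%:R :> R, 0 <= rho N,
    rho N <= rem_tilt beta N / 2 & rem_tilt beta N * rho N = ln N%:R / 8].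
  near=> N; have N0 : (0 < N)%N by near: N; exact: nbhs_infty_gt.
  have l1 : 1 <= ln N%:R :> R by near: N.
  have s1 : 1 <= Num.sqrt N%:R :> R by exact: sqrt_natr_ge1.
  have s0 : 0 < Num.sqrt N%:R :> R by exact: lt_le_trans s1.
  have rb : `|rho N| <= beta / 2.
    by near: N; apply: (cvgr0_norm_le _ rho_cvg); rewrite divr_gt0.
  split => //.
  - by rewrite divr_ge0 ?mulr_ge0 ?(ltW beta0) ?(ltW s0)// (le_trans ler01 l1).
  - by rewrite (le_trans (ler_norm _))// (le_trans rb)// ler_pM2r// /rem_tilt ler_peMr// ltW.
  - by rewrite /rem_tilt /rho; field; rewrite (lt0r_neq0 s0) (lt0r_neq0 beta0).
have thetaE N : rem_tilt beta N ^+ 2 = beta ^+ 2 * N%:R.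
  by rewrite exprMn sqr_sqrtr.
have theta_inv N : (0 < N)%N -> (rem_tilt beta N)^-1 = beta^-1 * expR (- (ln N%:R / 2)).
  by move=> N0; rewrite /rem_tilt invfM sqrt_natr_expR// expRN.
have b2l : beta ^+ 2 < ln 2 by rewrite ln2E; have := exprn_gt0 2 beta0; lra.
have small_tilt : t N * (rem_scale beta N / rem_card N) * (1 + rem_cutoff beta L N)
    @[N --> \oo] --> (0 : R).
  apply: small_tilt_of_cutoff => //.
  have k10 : 0 < 8^-1 :> R by rewrite invr_gt0.
  apply: cvg0_norm_le (cvg_ln_expRN _ k10); near=> N.
  have [N0 l1 r0 rt tr] : [/\ (0 < N)%N, 1 <= ln N%:R :> R, 0 <= rho N,
    rho N <= rem_tilt beta N / 2 & rem_tilt beta N * rho N = ln N%:R / 8] by near: N.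
  have t1N : 1 <= t N by near: N.
  have tN : t N <= ln N%:R by near: N.
  have t0 : 0 <= t N by exact: le_trans t1N.
  rewrite -mulrA ger0_norm; last by rewrite !mulr_ge0 ?expR_ge0 ?invr_ge0// exprn_ge0.
  rewrite (_ : rem_scale beta N / rem_card N * rem_cutoff beta L N = expR (- (8^-1 * ln N%:R))).
    by rewrite ler_wpM2r ?expR_ge0.
  rewrite rem_cardE /rem_scale /rem_cutoff -expRB -expRD; congr expR.
  rewrite /L [rem_tilt beta N * (_ - _)]mulrBr tr mulrCA -expr2 thetaE ln2E; by field.
have small_tail : rem_scale beta N * rem_tail beta L N / t N @[N --> \oo] --> (0 : R).
  have k20 : 0 < 3 / 8 :> R by rewrite divr_gt0.
  apply: cvg0_norm_le (decay _ (2 / beta) k20); near=> N.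
  have [N0 l1 r0 rt tr] : [/\ (0 < N)%N, 1 <= ln N%:R :> R, 0 <= rho N,
    rho N <= rem_tilt beta N / 2 & rem_tilt beta N * rho N = ln N%:R / 8] by near: N.
  have t1N : 1 <= t N by near: N.
  have t0 : 0 < t N by exact: lt_le_trans t1N.
  have th0 : 0 < rem_tilt beta N by rewrite mulr_gt0// sqrtr_gt0 ltr0n.
  have e0 : 0 <= rem_scale beta N * rem_tail beta L N by rewrite mulr_ge0 ?expR_ge0 ?tilt_tail_ge0.
  rewrite ger0_norm ?divr_ge0 ?(ltW t0)//.
  apply: (@le_trans _ _ (rem_scale beta N * rem_tail beta L N)).
    by rewrite ler_pdivrMr// ler_peMr.
  have tL : rem_tilt beta N < L N by rewrite /L; lra.
  have Lt : L N - rem_tilt beta N = rem_tilt beta N - rho N by rewrite /L; ring.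
  have inv_le : (rem_tilt beta N - rho N)^-1 <= 2 / beta * expR (- (ln N%:R / 2)).
    rewrite -mulrA -theta_inv// -invf_div lef_pV2 ?posrE; lra.
  apply: (@le_trans _ _ (expR (ln N%:R / 8) * (2 / beta * expR (- (ln N%:R / 2))))).
    apply: (@le_trans _ _ (rem_scale beta N * (expR (- ((rem_tilt beta N - rho N) ^+ 2 / 2)) / (rem_tilt beta N - rho N)))).
      by rewrite ler_wpM2l ?expR_ge0// -Lt; exact: tilt_tail_le.
    rewrite mulrA ler_pM ?mulr_ge0 ?expR_ge0 ?invr_ge0//; first lra.
    rewrite /rem_scale -expRD ler_expR sqrrB thetaE ln2E mulr_natl -mulrnAl.
    have := sqr_ge0 (rho N); have := tr; lra.
  rewrite mulrCA -expRD (_ : ln N%:R / 8 + _ = - (3 / 8 * ln N%:R)); last by field.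
  by rewrite ler_wpM2l ?divr_ge0 ?(ltW beta0)// le_mulln// expR_ge0.
have head_cvg : rem_head beta L N @[N --> \oo] --> (2^-1 : R).
  apply/cvgrPdist_le => e e0; near=> N.
  have [N0 l1 r0 rt tr] : [/\ (0 < N)%N, 1 <= ln N%:R :> R, 0 <= rho N,
    rho N <= rem_tilt beta N / 2 & rem_tilt beta N * rho N = ln N%:R / 8] by near: N.
  have re : `|rho N| <= e by near: N; exact: (cvgr0_norm_le _ rho_cvg).
  have Lt : L N <= 2 * rem_tilt beta N by rewrite /L gerBl.
  apply: le_trans (tilt_head_half _ _ Lt) _; rewrite /L opprB addrC subrK.
  exact: le_trans (ler_norm _) re.
have rare C : \forall N \near \oo,
    ((rem_card N)%:E * normal_prob 0 1 `]L N, +oo[%classic <= (expR (- (t N ^+ 2 * C)))%:E)%E.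
  pose e : R := Num.sqrt (8^-1 / (`|C| + 1)).
  have C0 : 0 < `|C| + 1 by rewrite ltr_wpDl.
  have e0 : 0 < e by rewrite sqrtr_gt0 !divr_gt0.
  near=> N.
  have [N0 l1 r0 rt tr] : [/\ (0 < N)%N, 1 <= ln N%:R :> R, 0 <= rho N,
    rho N <= rem_tilt beta N / 2 & rem_tilt beta N * rho N = ln N%:R / 8] by near: N.
  have te : `|t N| <= e * Num.sqrt (ln N%:R) by near: N; exact: tsmall.
  have ex : beta^-1 * expR (- (ln N%:R * 4^-1)) <= expR (- (ln N%:R * 8^-1)).
    near: N; apply: le_exp_bounds_near; first exact: cvg_ln_natr_infty.
    by rewrite ltf_pV2 ?posrE// ltr_nat.
  have th0 : 0 < rem_tilt beta N by rewrite mulr_gt0// sqrtr_gt0 ltr0n.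
  have L0 : 0 < L N by rewrite /L; lra.
  have td : expR (N%:R * ln 2) * fine (normal_prob 0 1 `]L N, +oo[%classic) <=
      beta^-1 * expR (- (ln N%:R * 4^-1)).
    apply: (@le_trans _ _ (expR (N%:R * ln 2) * (expR (- (L N ^+ 2 / 2)) / L N))).
      by rewrite ler_wpM2l ?expR_ge0//; have := tilt_tail_le 0 _ L0; rewrite subr0.
    apply: (@le_trans _ _ (expR (ln N%:R / 4) * (beta^-1 * expR (- (ln N%:R / 2))))).
      rewrite mulrA ler_pM ?mulr_ge0 ?expR_ge0 ?invr_ge0 ?(ltW L0)//.
        have LE : L N ^+ 2 = 4 * rem_tilt beta N ^+ 2 - 4 * (rem_tilt beta N * rho N) + rho N ^+ 2.
          by rewrite /L; ring.
        by rewrite -expRD ler_expR LE tr thetaE ln2E; have := sqr_ge0 (rho N); lra.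
      rewrite -theta_inv// lef_pV2 ?posrE// /L; lra.
    rewrite mulrCA -expRD (_ : ln N%:R / 4 + _ = - (ln N%:R * 4^-1))//; by field.
  rewrite -(normal_prob_fineK 0)// -EFinM lee_fin rem_cardE; apply: le_trans td _.
  apply: le_trans ex _; rewrite ler_expR lerN2.
  have t2 : t N ^+ 2 <= 8^-1 / (`|C| + 1) * ln N%:R.
    have eE : e ^+ 2 = 8^-1 / (`|C| + 1) by rewrite sqr_sqrtr// ltW// !divr_gt0.
    have sE : ln N%:R = Num.sqrt (ln N%:R) ^+ 2 :> R by rewrite sqr_sqrtr// (le_trans ler01 l1).
    rewrite -eE sE -exprMn -(real_normK (num_real (t N))).
    by rewrite lerXn2r ?nnegrE ?mulr_ge0 ?(ltW e0) ?sqrtr_ge0.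
  apply: (@le_trans _ _ (t N ^+ 2 * (`|C| + 1))).
    by rewrite ler_wpM2l ?sqr_ge0// (le_trans (ler_norm _))// lerDl.
  by apply: le_trans (ler_wpM2r (ltW C0) t2) _; rewrite mulrAC divfK ?lt0r_neq0// mulrC.
have koo := scale_t_infty _ _ too tle b2l.
have st := small_t2_card _ too tle.
have v0 : 0 < 2^-1 :> R by rewrite invr_gt0.
split=> [r s|x delta r].
- exact: (rem_upper P X beta 2^-1 t L remX beta0 too v0 small_tilt small_tail head_cvg st rare koo).
- exact: (rem_lower P X beta 2^-1 t L remX beta0 too v0 small_tilt small_tail head_cvg st rare koo).
Unshelve. all: by end_near. Qed.

End critical.

Section strong_scaling.
Context {d : measure_display} {T : measurableType d} {R : realType}.
Variable P : probability T R.
Variable X : forall N, spins N -> {RV P >-> R}.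
Variables (beta : R) (t gamma : nat -> R).
Hypothesis remX : rem_disorder X.
Hypothesis beta0 : 0 < beta.
Hypothesis bsub : beta < Num.sqrt (ln 2 / 2).
Hypothesis tlarge : (0 < limn_einf (fun N => (t N / Num.sqrt N%:R)%:E))%E.
Hypothesis goo : gamma @ \oo --> +oo.
Hypothesis gsmall : forall e, 0 < e -> \forall N \near \oo, `|gamma N| <= e * N%:R.

Lemma rem_concentration rho r : 0 < rho ->
  \forall N \near \oo,
    (P [set w | rho <= `|scaled_log_partition X t beta N w|]%R <= (expR (- (gamma N * r)))%:E)%E.
Proof.
move=> rho0; pose u N := Num.sqrt (gamma N).
have g0 : \forall N \near \oo, 0 < gamma N by have /cvgryPgt := goo; exact.
have uoo : u @ \oo --> +oo.
  apply/cvgryPge => C; near=> N.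
  have : Num.max 0 C ^+ 2 <= gamma N by near: N; have /cvgryPge := goo; exact.
  move=> /ler_wsqrtr; rewrite sqrtr_sqr ger0_norm ?le_max ?lexx//.
  by rewrite ge_max => /andP[].
have usmall e : 0 < e -> \forall N \near \oo, `|u N| <= e * Num.sqrt N%:R.
  move=> e0; have e20 : 0 < e ^+ 2 by rewrite exprn_gt0.
  apply: filterS (gsmall _ e20) => N gN; rewrite ger0_norm ?sqrtr_ge0//.
  rewrite -(ger0_norm (ltW e0)) -sqrtr_sqr -sqrtrM ?sqr_ge0// ler_wsqrtr//.
  exact: le_trans (ler_norm _) gN.
have [c /andP[c0 ct]] := lte_between_real _ _ tlarge; rewrite lte_fin in c0.
have tc := lt_limn_einf_near _ _ ct.
pose K : R := Num.sqrt (2 * (`|r| + 1)).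
have K0 : 0 < K by rewrite sqrtr_gt0 mulr_gt0// ltr_wpDl.
have K2 : r < K ^+ 2 / (2 * 1).
  rewrite sqr_sqrtr ?mulr_ge0 ?addr_ge0// mulr1 mulrAC mulfV// mul1r.
  by rewrite (le_lt_trans (ler_norm _))// ltrDl.
have [up _] := rem_subcritical_mdp P X beta u remX beta0 uoo bsub usmall.
have eps0 : 0 < rho * c / K by rewrite divr_gt0// mulr_gt0.
near=> N.
have N0 : (0 < N)%N by near: N; exact: nbhs_infty_gt.
have s0 : 0 < Num.sqrt N%:R :> R by rewrite sqrtr_gt0 ltr0n.
have gN : 0 < gamma N by near: N.
have u0 : 0 < u N by rewrite sqrtr_gt0.
have u2 : u N ^+ 2 = gamma N by rewrite sqr_sqrtr// ltW.
have tN : c < t N / Num.sqrt N%:R by rewrite -lte_fin; near: N.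
have uN : `|u N| <= rho * c / K * Num.sqrt N%:R by near: N; exact: usmall.
have UN : (P [set w | K <= `|scaled_log_partition X u beta N w|]%R <= (expR (- (u N ^+ 2 * r)))%:E)%E.
  by near: N; exact: up.
rewrite u2 in UN; apply: le_trans UN.
apply: le_measure; rewrite ?inE;
  [exact/measurable_le_norm/measurable_scaled_log_partition|
   exact/measurable_le_norm/measurable_scaled_log_partition|].
rewrite ltr_pdivlMr// in tN.
have t0 : 0 < t N by apply: lt_trans tN; rewrite mulr_gt0.
move=> w /=; rewrite /scaled_log_partition.
set A := expR _; set l := ln _ => rhoW.
have -> : A / u N * l = (t N / u N) * (A / t N * l).
  by field; rewrite (lt0r_neq0 t0) (lt0r_neq0 u0).
rewrite normrM gtr0_norm ?divr_gt0//.
apply: (@le_trans _ _ (t N / u N * rho)); last by rewrite ler_wpM2l// ltW// divr_gt0.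
rewrite gtr0_norm// [leRHS]mulrAC ler_pdivlMr// in uN.
rewrite mulrAC ler_pdivlMr// mulrC (le_trans uN)// [leRHS]mulrC -mulrA ler_wpM2l ?(ltW rho0)//.
exact: ltW.
Unshelve. all: by end_near. Qed.

End strong_scaling.

Theorem theorem1p4 (R : realType) (d : measure_display) (T : measurableType d)
    (P : probability T R) (X : forall N : nat, spins N -> {RV P >-> R})
    (t : nat -> R) (beta : R) :
  rem_disorder X ->
  t @ \oo --> +oo ->
  0 < beta ->
  let W : nat -> {RV P >-> R} := fun N => scaled_log_partition X t beta N in
  (beta < Num.sqrt (ln 2 / 2) ->
    (t =o_\oo (fun N => Num.sqrt N%:R : R) ->
      let I := fun x : R => (x ^+ 2 / 2)%:E in
      ldp W (fun N => t N ^+ 2) I /\ good_rate_function I) /\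
    ((0 < limn_einf (fun N => (t N / Num.sqrt N%:R)%:E))%E ->
      forall gamma : nat -> R,
        gamma @ \oo --> +oo -> gamma =o_\oo (fun N => N%:R : R) ->
        let I := fun x : R => if x == 0 then 0%E else +oo%E : \bar R in
        ldp W gamma I /\ good_rate_function I)) /\
  (beta = Num.sqrt (ln 2 / 2) ->
    t =o_\oo (fun N => Num.sqrt (ln N%:R) : R) ->
    let I := fun x : R => (x ^+ 2)%:E in
    ldp W (fun N => t N ^+ 2) I /\ good_rate_function I).
Proof.
move=> remX too beta0 W.
have t2oo : (fun N => t N ^+ 2) @ \oo --> +oo.
  apply/cvgryPge => C; near=> N.
  have t1 : Num.max 1 C <= t N by near: N; have /cvgryPge := too; exact.
  move: t1; rewrite ge_max => /andP[t1 tC].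
  by rewrite (le_trans tC)// expr2 ler_peMr// (le_trans ler01 t1).
split=> [bsub|bcrit].
  split=> [/eqoP to|tlarge gamma goo /eqoP gsmall] I.
    have tsmall e : 0 < e -> \forall N \near \oo, `|t N| <= e * Num.sqrt N%:R.
      by move=> e0; apply: filterS (to e e0) => N; rewrite [X in _ * X]ger0_norm ?sqrtr_ge0.
    have [up lo] := rem_subcritical_mdp P X beta t remX beta0 too bsub tsmall.
    have -> : I = quadratic_rate 1 by apply/funext => x; rewrite /I /quadratic_rate mulr1.
    by split; [exact: ldp_quadratic|exact: quadratic_rate_good].
  split; last exact: point_rate_good.
  apply: ldp_point => // rho r rho0; apply: rem_concentration => // e e0.
  by apply: filterS (gsmall e e0) => N; rewrite [X in _ * X]ger0_norm.
move=> /eqoP to I.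
have b2 : beta ^+ 2 = ln 2 / 2 by rewrite bcrit sqr_sqrtr// divr_ge0// ltW// ln2_gt0.
have tsmall e : 0 < e -> \forall N \near \oo, `|t N| <= e * Num.sqrt (ln N%:R).
  by move=> e0; apply: filterS (to e e0) => N; rewrite [X in _ * X]ger0_norm ?sqrtr_ge0.
have [up lo] := rem_critical_mdp P X beta t remX beta0 too b2 tsmall.
have -> : I = quadratic_rate 2^-1.
  by apply/funext => x; rewrite /I /quadratic_rate mulfV// divr1.
have v0 : 0 < 2^-1 :> R by rewrite invr_gt0.
by split; [exact: ldp_quadratic|exact: quadratic_rate_good].
Unshelve. all: by end_near. Qed.
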